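(* Let $\mathbf{k}$ be a field, $G$ an abelian group, $\lambda:G\times G\to\mathbf{k}^*$ a bicharacter, and $H$ a $(G,\lambda)$-graded Hopf algebra over $\mathbf{k}$ generated as an algebra by homogeneous primitive elements $a_1,\ldots,a_n$ with fixed positive integer degrees $d_1,\ldots,d_n$. Then the set of all monotonic restricted words in hard super-letters constitutes a basis of $H$ over $\mathbf{k}$. In other words, the elements $[u_1]^{n_1}\cdots[u_k]^{n_k}$ with $k\ge0$, $u_1<\cdots<u_k$ standard words such that every $[u_i]$ is hard, and each $n_i\ge1$ less than the height of $[u_i]$, form a basis of $H$.
   Context: $(G,\lambda)$-graded Hopf algebra. $H=\bigoplus_{g\in G}H_g$ is a $G$-graded algebra and a $G$-graded coalgebra such that $\Delta:H\to H\otimes H$ and $\varepsilon:H\to\mathbf{k}$ are algebra homomorphisms, where $H\otimes H$ carries the multiplication $(a\otimes b)(c\otimes d)=\lambda(g_b,g_c)\,ac\otimes bd$ for homogeneous $b\in H_{g_b}$, $c\in H_{g_c}$, and such that there is a grading-preserving antipode (convolution inverse of the identity). An element $a$ is primitive if $\Delta(a)=a\otimes1+1\otimes a$. Words. Consider words in the alphabet $a_1,\ldots,a_n$, where $a_i\in H_{g_i}$, ordered lexicographically with $a_1>a_2>\cdots>a_n$: two words are compared from left to right at the first distinct letter, and a proper beginning of a word is greater than that word. For a word $u$ let $g_u\in G$ be obtained from $u$ by replacing each letter $a_i$ by $g_i$, and put $p_{uv}=\lambda(g_v,g_u)^{-1}$. A word $u$ with $m_i$ occurrences of $a_i$ has constitution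 $(m_1,\ldots,m_n)$ and degree $\deg(u)=m_1d_1+\cdots+m_nd_n$. Standard words. A nonempty word $u$ is standard if $u>u_2u_1$ for each factorization $u=u_1u_2$ into nonempty words. A nonassociative (fully bracketed) word $[u]$ is standard if: (1) the word $u$ obtained by erasing brackets is standard; (2) if $[u]=[[v][w]]$ then $[v]$, $[w]$ are standard nonassociative words; (3) if $[u]=[[[v_1][v_2]][w]]$ then $v_2\le w$. By a theorem of Shirshov each standard word has a unique bracketing that is a standard nonassociative word (for $u$ of length $\ge 2$ it is $[[v][w]]$ with $u=vw$, $v,w$ standard and $v$ of least possible length). Super-letters and super-words. For a standard word $u$, the super-letter $[u]$ is the polynomial obtained from the standard nonassociative word $[u]$ by interpreting brackets as the skew commutator, defined on polynomials homogeneous in each variable by $[f,h]=fh-p_{uv}hf$, where $u,v$ are any words having the constitutions of $f,h$. It is evaluated as an element of $H$. Super-letters are indexed by standard words and ordered by $[u]>[v]\iff u>v$. A super-word is a (formal) word in super-letters; its degree is the sum of the degrees of its super-letters, with $\deg[u]=\deg(u)$. A super-word is monotonic if it has the form $[u_1]^{n_1}\cdots[u_k]^{n_k}$ with $u_1<\cdots<u_k$. Hard super-letters and heights. A super-letter $[u]$ is hard if in $H$ it is not a linear combination of super-words of degree $\deg(u)$ in super-letters less than $[u]$ and of super-words of degree less than $\deg(u)$. The height of $[u]$ (of degree $d$) is the least natural number $h$ such that (1) $p_{uu}$ is a primitive $t$-th root of unity for some $t\ge1$, and either $h=t$ or $h=tl^k$ where $l>0$ is the characteristic of $\mathbf{k}$;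 and (2) $[u]^h$ is in $H$ a linear combination of super-words of degree $hd$ in super-letters less than $[u]$ and of super-words of degree less than $hd$. If no such $h$ exists, the height is infinite. A monotonic super-word $[u_1]^{n_1}\cdots[u_k]^{n_k}$ is restricted if each $n_i$ is less than the height of $[u_i]$. *)

(* Defs.v *)
(* The abelian group G is written additively. *)
From HB Require Import structures.
From mathcomp Require Import all_boot all_order all_algebra.

Set Implicit Arguments.
Unset Strict Implicit.
Unset Printing Implicit Defensive.

Import Order.TTheory GRing.Theory Num.Theory.
Local Open Scope ring_scope.

Definition lincomb (K : fieldType) (V : lmodType K) (I : Type)
    (D : I -> Prop) (e : I -> V) (x : V) : Prop :=
  exists m (w : 'I_m -> I) (c : 'I_m -> K),
    (forall j, D (w j)) /\ x = \sum_j c j *: e (w j).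

Definition lin_indep (K : fieldType) (V : lmodType K) (I : Type)
    (D : I -> Prop) (e : I -> V) : Prop :=
  forall m (w : 'I_m -> I) (c : 'I_m -> K),
    injective w -> (forall j, D (w j)) ->
    \sum_j c j *: e (w j) = 0 -> forall j, c j = 0.

Definition is_basis (K : fieldType) (V : lmodType K) (I : Type)
    (D : I -> Prop) (e : I -> V) : Prop :=
  lin_indep D e /\ forall x, lincomb D e x.

(* [T] is a tensor product of [U] and [V], given by its universal property;
   [tens_lift B] is the linear map induced by the bilinear map [B] (its value
   is irrelevant when [B] is not bilinear). *)
Record tensor_product (K : fieldType) (U V T : lmodType K) := TensorProduct {
  tens : U -> V -> T;
  tens_lift : forall W : lmodType K, (U -> V -> W) -> T -> W;
  tens_bilinear : bilinear_for *:%R *:%R tens;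
  tens_lift_linear : forall (W : lmodType K) (B : U -> V -> W),
    bilinear_for *:%R *:%R B -> linear (tens_lift B);
  tens_liftE : forall (W : lmodType K) (B : U -> V -> W),
    bilinear_for *:%R *:%R B -> forall u v, tens_lift B (tens u v) = B u v;
  tens_ext : forall (W : lmodType K) (f f' : T -> W),
    linear f -> linear f' ->
    (forall u v, f (tens u v) = f' (tens u v)) -> forall t, f t = f' t
}.

Record bicharacter (K : fieldType) (G : zmodType) (lambda : G -> G -> K)
    : Prop := Bicharacter {
  bichar_neq0 : forall g h, lambda g h != 0;
  bicharDl : forall g g' h, lambda (g + g') h = lambda g h * lambda g' h;
  bicharDr : forall g h h', lambda g (h + h') = lambda g h * lambda g h'
}.

Record direct_sum (K : fieldType) (G : zmodType) (V : lmodType K)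
    (gr : G -> {pred V}) : Prop := DirectSum {
  dsum_submod : forall g, submod_closed (gr g);
  dsum_span : forall x, exists (s : seq G) (c : G -> V),
    (forall g, c g \in gr g) /\ x = \sum_(g <- s) c g;
  dsum_indep : forall (s : seq G) (c : G -> V),
    uniq s -> (forall g, c g \in gr g) -> \sum_(g <- s) c g = 0 ->
    forall g, g \in s -> c g = 0
}.

(* Since [tens_lift tHH B (Delta x)] is the sum of the [B x_(1) x_(2)] in
   Sweedler notation, the coalgebra and antipode axioms are stated with it.
   [HH] is H (x) H, with the multiplication twisted by [lambda], and [HHH] is
   H (x) (H (x) H). *)
Record graded_hopf (K : fieldType) (G : zmodType) (lambda : G -> G -> K)
    (H : algType K) := GradedHopf {
  grading : G -> {pred H};
  grading_dsum : direct_sum grading;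
  grading1 : 1 \in grading 0;
  gradingM : forall g h x y,
    x \in grading g -> y \in grading h -> x * y \in grading (g + h);
  HH : algType K;
  tHH : tensor_product H H HH;
  tHH_mul : forall gb gc (a b c d : H), b \in grading gb -> c \in grading gc ->
    tens tHH a b * tens tHH c d
      = lambda gb gc *: tens tHH (a * c) (b * d);
  HHH : lmodType K;
  tHHH : tensor_product H HH HHH;
  Delta : {lrmorphism H -> HH};
  eps : {lrmorphism H -> K^o};
  Delta_coassoc : forall x,
    tens_lift tHH (fun y z =>
      tens_lift tHH (fun y1 y2 => tens tHHH y1 (tens tHH y2 z)) (Delta y))
      (Delta x)
    = tens_lift tHH (fun y z => tens tHHH y (Delta z)) (Delta x);
  eps_counitl : forall x,
    tens_lift tHH (fun y z => (eps y : K) *: z) (Delta x) = x;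
  eps_counitr : forall x,
    tens_lift tHH (fun y z => (eps z : K) *: y) (Delta x) = x;
  Delta_graded : forall g x, x \in grading g ->
    exists m (g1 g2 : 'I_m -> G) (y z : 'I_m -> H),
      (forall j, [/\ y j \in grading (g1 j), z j \in grading (g2 j)
                   & g1 j + g2 j = g])
      /\ Delta x = \sum_j tens tHH (y j) (z j);
  eps_graded : forall g x, x \in grading g -> g != 0 -> eps x = 0;
  antipode : {linear H -> H};
  antipode_graded : forall g x, x \in grading g -> antipode x \in grading g;
  antipodel : forall x,
    tens_lift tHH (fun y z => antipode y * z) (Delta x) = (eps x : K)%:A;
  antipoder : forall x,
    tens_lift tHH (fun y z => y * antipode z) (Delta x) = (eps x : K)%:A
}.

Definition primitive_elt (K : fieldType) (G : zmodType) (lambda : G -> G -> K)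
    (H : algType K) (S : graded_hopf lambda H) (x : H) : Prop :=
  Delta S x = tens (tHH S) x 1 + tens (tHH S) 1 x.

Definition generates (K : fieldType) (H : algType K) (I : Type) (a : I -> H)
    : Prop :=
  forall A : {pred H}, subalg_closed A -> (forall i, a i \in A) ->
  forall x, x \in A.

(* The letter [i : 'I_n] stands for the (i+1)-st letter, and letters decrease
   as their indices increase.  Thus both comparison of letters and of a word
   with its proper beginnings are reversed with respect to the library's
   lexicographic order on sequences of indices. *)
Definition wlt n (u v : seq 'I_n) : bool :=
  ((v : seqlexi 'I_n) < (u : seqlexi 'I_n))%O.

Definition wle n (u v : seq 'I_n) : bool := (u == v) || wlt u v.

Definition standard n (u : seq 'I_n) : bool :=
  (u != [::]) &&
  [forall i : 'I_(size u), (0 < i)%N ==> wlt (drop i u ++ take i u) u].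

Inductive nword (n : nat) : Type :=
  | NLetter of 'I_n
  | NBracket of nword n & nword n.

Lemma nword_eq_dec n : comparable (nword n).
Proof.
by move=> x y; rewrite /decidable; decide equality; apply: eq_comparable.
Defined.

HB.instance Definition _ n :=
  hasDecEq.Build (nword n) (compareP (@nword_eq_dec n)).

Fixpoint erase n (t : nword n) : seq 'I_n :=
  match t with
  | NLetter i => [:: i]
  | NBracket t1 t2 => erase t1 ++ erase t2
  end.

Fixpoint nstandard n (t : nword n) : bool :=
  standard (erase t) &&
  match t with
  | NLetter _ => true
  | NBracket t1 t2 =>
      [&& nstandard t1, nstandard t2
        & match t1 with
          | NLetter _ => true
          | NBracket _ t12 => wle (erase t12) (erase t2)
          end]
  end.

(* By Shirshov's theorem [t |-> erase (val t)] is a bijection onto the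
   standard words, so that this type indexes the super-letters [u]. *)
Definition superletter n : Type := {t : nword n | nstandard t}.

HB.instance Definition _ n := SubEquality.on (superletter n).

Definition sl_word n (t : superletter n) : seq 'I_n := erase (val t).

Definition sl_lt n (t t' : superletter n) : bool :=
  wlt (sl_word t) (sl_word t').

Definition superword n : Type := seq (superletter n).

Definition wdeg n (d : 'I_n -> nat) (u : seq 'I_n) : nat :=
  (\sum_(i <- u) d i)%N.

Definition sw_deg n (d : 'I_n -> nat) (w : superword n) : nat :=
  (\sum_(t <- w) wdeg d (sl_word t))%N.

Definition wgrade (G : zmodType) n (g : 'I_n -> G) (u : seq 'I_n) : G :=
  \sum_(i <- u) g i.

Definition pcoef (K : fieldType) (G : zmodType) (lambda : G -> G -> K) n
    (g : 'I_n -> G) (u v : seq 'I_n) : K :=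
  (lambda (wgrade g v) (wgrade g u))^-1.

Fixpoint nword_eval (K : fieldType) (G : zmodType) (lambda : G -> G -> K)
    (H : algType K) n (g : 'I_n -> G) (a : 'I_n -> H) (t : nword n) : H :=
  match t with
  | NLetter i => a i
  | NBracket t1 t2 =>
      let x1 := nword_eval lambda g a t1 in
      let x2 := nword_eval lambda g a t2 in
      x1 * x2 - pcoef lambda g (erase t1) (erase t2) *: (x2 * x1)
  end.

Definition sl_eval (K : fieldType) (G : zmodType) (lambda : G -> G -> K)
    (H : algType K) n (g : 'I_n -> G) (a : 'I_n -> H) (t : superletter n) : H :=
  nword_eval lambda g a (val t).

Definition sw_eval (K : fieldType) (G : zmodType) (lambda : G -> G -> K)
    (H : algType K) n (g : 'I_n -> G) (a : 'I_n -> H) (w : superword n) : H :=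
  \prod_(t <- w) sl_eval lambda g a t.

Definition sw_lower n (d : 'I_n -> nat) (t : superletter n) (m : nat)
    (w : superword n) : Prop :=
  (sw_deg d w = m /\ all (fun t' => sl_lt t' t) w) \/ (sw_deg d w < m)%N.

Definition hard (K : fieldType) (G : zmodType) (lambda : G -> G -> K)
    (H : algType K) n (g : 'I_n -> G) (a : 'I_n -> H) (d : 'I_n -> nat)
    (t : superletter n) : Prop :=
  ~ lincomb (sw_lower d t (wdeg d (sl_word t))) (sw_eval lambda g a)
      (sl_eval lambda g a t).

Definition height_cond (K : fieldType) (G : zmodType) (lambda : G -> G -> K)
    (H : algType K) n (g : 'I_n -> G) (a : 'I_n -> H) (d : 'I_n -> nat)
    (t : superletter n) (h : nat) : Prop :=
  (exists2 m : nat,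
     m.-primitive_root (pcoef lambda g (sl_word t) (sl_word t)) &
     h = m \/ exists l k : nat, l \in [pchar K] /\ h = (m * l ^ k)%N)
  /\ lincomb (sw_lower d t (h * wdeg d (sl_word t))) (sw_eval lambda g a)
       (sl_eval lambda g a t ^+ h).

(* No [h] satisfies this when the height is infinite. *)
Definition is_height (K : fieldType) (G : zmodType) (lambda : G -> G -> K)
    (H : algType K) n (g : 'I_n -> G) (a : 'I_n -> H) (d : 'I_n -> nat)
    (t : superletter n) (h : nat) : Prop :=
  height_cond lambda g a d t h /\
  forall h', height_cond lambda g a d t h' -> (h <= h')%N.

Definition lt_height (K : fieldType) (G : zmodType) (lambda : G -> G -> K)
    (H : algType K) n (g : 'I_n -> G) (a : 'I_n -> H) (d : 'I_n -> nat)
    (t : superletter n) (m : nat) : Prop :=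
  forall h, is_height lambda g a d t h -> (m < h)%N.

(* The list [:: (u_1, n_1); ...; (u_k, n_k)] encodes the super-word
   [u_1]^n_1 ... [u_k]^n_k. *)
Definition monotonic n (w : seq (superletter n * nat)) : Prop :=
  sorted (fun p q => sl_lt p.1 q.1) w /\ all (fun p => 0 < p.2)%N w.

Definition mon_superword n (w : seq (superletter n * nat)) : superword n :=
  flatten [seq nseq p.2 p.1 | p <- w].

Definition hard_restricted (K : fieldType) (G : zmodType)
    (lambda : G -> G -> K) (H : algType K) n (g : 'I_n -> G) (a : 'I_n -> H)
    (d : 'I_n -> nat) (w : seq (superletter n * nat)) : Prop :=
  forall p, p \in w ->
    hard lambda g a d p.1 /\ lt_height lambda g a d p.1 p.2.

(* Main.v *)
Require Import Defs.
From HB Require Import structures.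
From mathcomp Require Import all_boot all_order all_algebra.
From mathcomp Require Import boolp classical_sets zify.

(* Everything takes place in H, filtered by degree. For standard words v > w the
   bracket of [v] and [w] is a combination of super-words in super-letters at
   most [vw]; so every super-word reduces, downwards for the lexicographic order
   and modulo lower degree, to restricted monotonic words in hard super-letters.
   For independence, the coproduct of [u] is [u] (x) 1 + 1 (x) [u] plus tensors
   whose left factors are nonempty super-words in super-letters less than [u].
   In a relation of top degree m let [u] be the greatest super-letter occurring.
   A functional on the left tensor factor that picks the coefficient of [u]^k
   turns V [u]^N into a Gaussian binomial coefficient times V [u]^(N-k), which
   gives a relation of smaller degree. By induction these Gaussian binomials
   vanish for 0 < k <= N unless k deg [u] = m. Hence V is empty, and N is 1 or of
   the form t or t l^s with p_uu a primitive t-th root of unity; the relation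
   then says that [u] is not hard or that its height is at most N. *)

Set Implicit Arguments.
Unset Strict Implicit.
Unset Printing Implicit Defensive.

Import Order.TTheory GRing.Theory Num.Theory.
Local Open Scope ring_scope.

(** * Linear combinations *)

(** [H] need not be graded by degree, since relations may mix degrees; hence independence is proved
    for top-degree parts modulo super-words of lower degree. The functional attached to [[u]^k] must
    be 1 at [[u]^k], 0 in lower degree, and 0 on every super-word of the same degree with letters at
    most [u], one of them less. Its existence is where reduction and induction meet: such a
    super-word is less than [[u]^k], so it reduces to basis words other than [[u]^k] and to lower
    degree, and [[u]^k] is outside the span of these by independence in degree k deg [u]. That is
    known only below m, whence the exception k deg [u] = m. The Gaussian coefficients arise because
    [[u] (x) 1] and [1 (x) [u]] commute up to q = lambda(g_u, g_u), the inverse of p_uu. Their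
    vanishing is read off the product of the polynomials 1 + q^i X: for q of order t and m a
    multiple of t it is a power of 1 - (-X)^t, and only Frobenius can suppress all middle
    coefficients of such a power. *)

Section LinearCombinations.
Variables (K : fieldType) (V : lmodType K) (I : Type).
Implicit Types (D : I -> Prop) (e : I -> V).

Lemma lincomb_gen D e i : D i -> lincomb D e (e i).
Proof.
move=> Di; exists 1%N, (fun=> i), (fun=> 1); split=> //.
by rewrite big_ord1 scale1r.
Qed.

Lemma lincomb0 D e : lincomb D e 0.
Proof.
by exists 0%N, (fun j : 'I_0 => match notF (ltn_ord j) with end), (fun=> 0);
  split=> [[]//|]; rewrite big_ord0.
Qed.

Lemma lincombZ D e c x : lincomb D e x -> lincomb D e (c *: x).
Proof.
case=> m [w [b [Dw ->]]]; exists m, w, (fun j => c * b j); split=> //.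
by rewrite scaler_sumr; apply: eq_bigr => j _; rewrite scalerA.
Qed.

Lemma lincombD D e x y : lincomb D e x -> lincomb D e y -> lincomb D e (x + y).
Proof.
case=> m [w [b [Dw ->]]] [m' [w' [b' [Dw' ->]]]].
exists (m + m')%N.
exists (fun j => match split j with inl k => w k | inr k => w' k end).
exists (fun j => match split j with inl k => b k | inr k => b' k end).
split=> [j|]; first by case: split.
rewrite big_split_ord /=; congr (_ + _); apply: eq_bigr => j _.
  by case: split (unsplitK (inl j : 'I_m + 'I_m')) => // k [->].
by case: split (unsplitK (inr j : 'I_m + 'I_m')) => // k [->].
Qed.

Lemma lincombN D e x : lincomb D e x -> lincomb D e (- x).
Proof. by rewrite -scaleN1r; apply: lincombZ. Qed.

Lemma lincombB D e x y : lincomb D e x -> lincomb D e y -> lincomb D e (x - y).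
Proof. by move=> Dx Dy; apply/lincombD/lincombN. Qed.

Lemma lincomb_sum D e (J : Type) (r : seq J) (P : pred J) (F : J -> V) :
  (forall j, P j -> lincomb D e (F j)) ->
  lincomb D e (\sum_(j <- r | P j) F j).
Proof.
by move=> DF; elim/big_ind: _ => //; [apply: lincomb0 | move=> *; apply: lincombD].
Qed.

Lemma lincomb_ind D e (Q : V -> Prop) :
  Q 0 -> (forall c x y, Q x -> Q y -> Q (c *: x + y)) ->
  (forall i, D i -> Q (e i)) -> forall x, lincomb D e x -> Q x.
Proof.
move=> Q0 QD Qe _ [m [w [b [Dw ->]]]].
by elim/big_rec: _ => // j y _ Qy; apply: QD => //; apply: Qe.
Qed.

Lemma lincomb_mono D D' e x : (forall i, D i -> D' i) ->
  lincomb D e x -> lincomb D' e x.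
Proof.
move=> DD'; apply: lincomb_ind => [|c y z Hy Hz|i Di]; first exact: lincomb0.
  by apply: lincombD => //; apply: lincombZ.
exact/lincomb_gen/DD'.
Qed.

End LinearCombinations.

Lemma lincomb_linear (K : fieldType) (V V' : lmodType K) (I J : Type)
    (D : I -> Prop) (e : I -> V) (D' : J -> Prop) (e' : J -> V') (f : V -> V') :
  linear f -> (forall i, D i -> lincomb D' e' (f (e i))) ->
  forall x, lincomb D e x -> lincomb D' e' (f x).
Proof.
move=> linf Df; have f0 : f 0 = 0.
  by have := linf (-1) 0 0; rewrite scaler0 add0r scaleN1r addNr.
apply: lincomb_ind => [|c y z Hy Hz|i Di]; last exact: Df.
  by rewrite f0; apply: lincomb0.
by rewrite linf; apply: lincombD => //; apply: lincombZ.
Qed.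

Lemma lincomb_trans (K : fieldType) (V : lmodType K) (I J : Type)
    (D : I -> Prop) (e : I -> V) (D' : J -> Prop) (e' : J -> V) :
  (forall i, D i -> lincomb D' e' (e i)) ->
  forall x, lincomb D e x -> lincomb D' e' x.
Proof. by move=> De; apply: (@lincomb_linear _ _ _ _ _ _ _ _ _ id). Qed.

Lemma lincombM (K : fieldType) (A : algType K) (I J L : Type)
    (D : I -> Prop) (e : I -> A) (D' : J -> Prop) (e' : J -> A)
    (D'' : L -> Prop) (e'' : L -> A) x y :
  (forall i j, D i -> D' j -> lincomb D'' e'' (e i * e' j)) ->
  lincomb D e x -> lincomb D' e' y -> lincomb D'' e'' (x * y).
Proof.
move=> De Hx Hy; move: x Hx.
apply: (lincomb_linear (f := fun x => x * y)) => [c u v|i Di].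
  by rewrite mulrDl -scalerAl.
move: y Hy; apply: (lincomb_linear (f := fun y => e i * y)) => [c u v|j Dj].
  by rewrite mulrDr -scalerAr.
exact: De.
Qed.

(** Zorn's lemma gives a maximal set [X] such that [v] is outside the span of [X] and the [e i].
    Modulo that span every [x] is a multiple of [v] with a unique coefficient, and this coefficient
    is [f x]. *)
Lemma separating_functional (K : fieldType) (V : lmodType K) (I : Type)
    (D : I -> Prop) (e : I -> V) (v : V) :
  ~ lincomb D e v ->
  exists f : V -> K^o, [/\ linear f, f v = 1 & forall i, D i -> f (e i) = 0].
Proof.
pose Z x := exists2 i, D i & x = e i.
pose Sp X := lincomb (fun x : V => X x \/ Z x) id.
move=> nv.
have [X [nX maxX]] : exists X : set V, ~ Sp X v /\
    forall Y : set V, (X `<` Y)%classic -> ~ ~ Sp Y v.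
  apply: Zorn_bigcup => F FP totF.
  (* A combination over the union of a chain already lives over one member. The first alternative
     covers the empty chain. *)
  have sub : forall x, Sp (\bigcup_(X in F) X)%classic x ->
      lincomb D e x \/ exists2 X, F X & Sp X x.
    have SpD X : forall x, lincomb D e x -> Sp X x.
      by apply: lincomb_trans => i Di; apply: lincomb_gen; right; exists i.
    apply: lincomb_ind => [|c x y|x [[X FX Xx]|[i Di ->]]].
    - by left; apply: lincomb0.
    - case=> [Dx|[X FX Xx]] [Dy|[Y FY Yy]].
      + by left; apply: lincombD => //; apply: lincombZ.
      + by right; exists Y => //; apply: lincombD => //; apply/lincombZ/SpD.
      + by right; exists X => //; apply: lincombD (SpD _ _ Dy); apply/lincombZ.
      + have mono A B : (A `<=` B)%classic -> forall z, Sp A z -> Sp B z.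
          by move=> AB z; apply: lincomb_mono => u [/AB|]; [left|right].
        by case: (totF _ _ FX FY) => [XY|YX]; right;
          [exists Y|exists X] => //; apply: lincombD; try apply: lincombZ => //;
          apply: mono Xx + apply: mono Yy.
    - by right; exists X => //; apply: lincomb_gen; left.
    - by left; apply: lincomb_gen.
  by move/sub => [/nv//|[X /FP]].
have dec x : exists c, Sp X (x - c *: v).
  have [Xx|nXx] := pselect (X x).
    by exists 0; rewrite scale0r subr0; apply: lincomb_gen; left.
  have /contrapT : ~ ~ Sp (fun y => X y \/ y = x) v.
    apply: maxX; split; first by move=> y; left.
    by move=> /(_ x) XX; apply/nXx/XX; right.
  have sub : forall y, Sp (fun y => X y \/ y = x) y -> exists c, Sp X (y - c *: x).
    apply: lincomb_ind => [|c y z [b Hy] [b' Hz]|y [[Xy|->]|Zy]].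
    - by exists 0; rewrite scale0r subr0; apply: lincomb0.
    - exists (c * b + b').
      have -> : c *: y + z - (c * b + b') *: x
              = c *: (y - b *: x) + (z - b' *: x).
        by rewrite scalerBr scalerDl scalerA opprD addrACA.
      by apply: lincombD => //; apply: lincombZ.
    - by exists 0; rewrite scale0r subr0; apply: lincomb_gen; left.
    - by exists 1; rewrite scale1r subrr; apply: lincomb0.
    - by exists 0; rewrite scale0r subr0; apply: lincomb_gen; right.
  case/sub=> c Hc; have [c0|c0] := eqVneq c 0.
    by case: nX; rewrite c0 scale0r subr0 in Hc.
  exists c^-1; rewrite -[x - _]opprK opprB.
  rewrite -[x in _ - x]scale1r -(mulVf c0) -scalerA -scalerBr.
  exact/lincombN/lincombZ.
have uniq x c c' : Sp X (x - c *: v) -> Sp X (x - c' *: v) -> c = c'.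
  move=> Hc Hc'; apply: contrapT => /eqP; rewrite -subr_eq0 => cc'.
  case: nX; rewrite -[v]scale1r -(mulVf cc') -scalerA.
  apply: lincombZ; rewrite scalerBl.
  have -> : c *: v - c' *: v = (x - c' *: v) - (x - c *: v).
    by rewrite opprB [RHS]addrC addrA subrK.
  exact: lincombB.
have [f Hf] := choice dec.
exists f; split=> [c x y||i Di].
- apply: (uniq (c *: x + y)); first exact: Hf.
  have -> : c *: x + y - (c * f x + f y) *: v
          = c *: (x - f x *: v) + (y - f y *: v).
    by rewrite scalerBr scalerDl scalerA opprD addrACA.
  by apply: lincombD; [apply: lincombZ|]; apply: Hf.
- by apply: (uniq v); [exact: Hf | rewrite scale1r subrr; apply: lincomb0].
- apply: (uniq (e i)); first exact: Hf.
  by rewrite scale0r subr0; apply: lincomb_gen; right; exists i.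
Qed.

(** * Standard words and standard bracketings *)

Section Words.
Variable n : nat.
Implicit Types (u v w z : seq 'I_n) (t : nword n).

Lemma wlt_trans : transitive (@wlt n).
Proof. by move=> v u w vu wv; apply: lt_trans wv vu. Qed.

Lemma wltxx u : wlt u u = false.
Proof. exact: ltxx. Qed.

Lemma wleE u v : wle u v = ((v : seqlexi 'I_n) <= (u : seqlexi 'I_n))%O.
Proof. by rewrite le_eqVlt eq_sym. Qed.

Lemma wlexx u : wle u u.
Proof. by rewrite wleE. Qed.

Lemma wltNge u v : wlt u v = ~~ wle v u.
Proof. by rewrite wleE -ltNge. Qed.

Lemma wltW u v : wlt u v -> wle u v.
Proof. by rewrite /wle => ->; rewrite orbT. Qed.

Lemma wle_trans : transitive (@wle n).
Proof. by move=> v u w; rewrite !wleE => vu wv; apply: le_trans wv vu. Qed.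

Lemma wlt_wle_trans v u w : wlt u v -> wle v w -> wlt u w.
Proof. by rewrite wleE => vu wv; apply: le_lt_trans wv vu. Qed.

Lemma wle_wlt_trans v u w : wle u v -> wlt v w -> wlt u w.
Proof. by rewrite wleE => vu wv; apply: lt_le_trans wv vu. Qed.

Lemma wlt_cons i j u v :
  wlt (i :: u) (j :: v) = (j < i)%O || ((i == j) && wlt u v).
Proof.
rewrite /wlt [LHS]ltxi_cons; case: (ltgtP j i) => //= [_|_]; rewrite ?implybT //.
Qed.

Lemma wlt_cat2l z u v : wlt (z ++ u) (z ++ v) = wlt u v.
Proof. by elim: z => //= i z IH; rewrite wlt_cons eqxx ltxx IH. Qed.

Lemma wle_cat2l z u v : wle (z ++ u) (z ++ v) = wle u v.
Proof. by rewrite /wle wlt_cat2l eqseq_cat // eqxx. Qed.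

Lemma wlt_nil u : wlt u [::] = (u != [::]).
Proof. by rewrite /wlt; case: u. Qed.

Lemma wlt_prefix u z : wlt (u ++ z) u = (z != [::]).
Proof. by rewrite -{2}[u]cats0 wlt_cat2l wlt_nil. Qed.

(** The case distinction separates the only situation in which appending letters can reverse a
    comparison: [v] is a proper beginning of [u]. *)
Lemma wltP u v : wlt u v ->
  (exists2 z, z != [::] & u = v ++ z) \/ forall z z', wlt (u ++ z) (v ++ z').
Proof.
elim: u v => [|i u IH] [|j v]; rewrite ?wltxx //.
- by left; exists (i :: u).
rewrite wlt_cons; case: (ltgtP j i) => //= [ji _|ij].
  by right=> z z'; rewrite wlt_cons ji.
rewrite ij => /IH [[z z0 ->]|uv]; [by left; exists z|right=> z z'].
by rewrite wlt_cons eqxx uv orbT.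
Qed.

Lemma wlt_catr u v z z' : (size u <= size v)%N -> wlt u v ->
  wlt (u ++ z) (v ++ z').
Proof.
move=> suv /wltP[[x x0 ux]|//]; move: suv; rewrite ux size_cat.
by rewrite -{2}[size v]addn0 leq_add2l leqn0 size_eq0 (negPf x0).
Qed.

Lemma standard_neq0 u : standard u -> u != [::].
Proof. by case/andP. Qed.

(** If uv < v, then uv < vu unless uv = vz. In that case both rotations vu and zv are less than uv,
    which gives u < z and zv < uv although u and z have the same length. *)
Lemma standard_suffix u v : standard (u ++ v) -> u != [::] -> v != [::] ->
  wlt v (u ++ v).
Proof.
move=> /andP[_ /forallP st] u0 v0.
have rot x y : x != [::] -> y != [::] -> x ++ y = u ++ v ->
    wlt (y ++ x) (u ++ v).
  move=> x0 y0 xy; have lt_xy : (size x < size (u ++ v))%N.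
    by rewrite -xy size_cat -addn1 leq_add2l lt0n size_eq0.
  have := st (Ordinal lt_xy); rewrite /= -xy lt0n size_eq0 x0.
  by rewrite drop_size_cat // take_size_cat.
rewrite wltNge; apply/negP; case/orP=> [/eqP/(congr1 size)/eqP|].
  by rewrite size_cat -{2}[size v]add0n eqn_add2r size_eq0 (negPf u0).
case/wltP => [[z z0 uv_vz]|/(_ [::] u)]; last first.
  rewrite cats0 => /wlt_trans/(_ (rot _ _ u0 v0 erefl)).
  by rewrite wltxx.
have := rot _ _ u0 v0 erefl; rewrite uv_vz wlt_cat2l => uz.
have := rot _ _ v0 z0 (esym uv_vz); rewrite wltNge => /negP; apply.
apply/wltW/wlt_catr => //; move/(congr1 size): uv_vz.
by rewrite !size_cat addnC => /addnI ->.
Qed.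

Lemma standardP u : u != [::] ->
  (forall x y, x != [::] -> y != [::] -> u = x ++ y -> wlt y u) -> standard u.
Proof.
move=> u0 Hu; rewrite /standard u0; apply/forallP=> -[i ltiu] /=.
apply/implyP=> i0; have := cat_take_drop i u.
set x := take i u; set y := drop i u => xy.
have y0 : y != [::] by rewrite -size_eq0 size_drop subn_eq0 -ltnNge.
have x0 : x != [::] by rewrite -size_eq0 size_takel ?(ltnW ltiu) // -lt0n.
rewrite -[u in wlt _ u]cats0; apply: wlt_catr; last exact: Hu (esym xy).
by rewrite -xy size_cat leq_addl.
Qed.

Lemma cat_eqP (u1 u2 x y : seq 'I_n) : u1 ++ u2 = x ++ y ->
  (exists z, x = u1 ++ z /\ u2 = z ++ y) \/
  (exists z, u1 = x ++ z /\ y = z ++ u2).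
Proof.
elim: u1 x => [|i u1 IH] [|j x] /=; first by move=> ->; left; exists [::].
- by move=> ->; left; exists (j :: x).
- by move=> <-; right; exists (i :: u1).
case=> -> /IH [[z [-> ->]]|[z [-> ->]]]; first by left; exists z.
by right; exists z.
Qed.

Lemma wlt_cat_standard v w : standard w -> v != [::] -> wlt w v -> wlt w (v ++ w).
Proof.
move=> stw v0 /wltP [[z z0 wvz]|/(_ [::] w)]; last by rewrite cats0.
by rewrite {1}wvz wlt_cat2l wvz standard_suffix // -wvz.
Qed.

(** A proper ending of vw is either an ending of w, at most w < vw, or zw with z a proper ending of
    v; then z < v, and since z is shorter the comparison survives appending. *)
Lemma standard_cat v w : standard v -> standard w -> wlt w v -> standard (v ++ w).
Proof.
move=> stv stw wv; have v0 := standard_neq0 stv; have w0 := standard_neq0 stw.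
have wvw := wlt_cat_standard stw v0 wv.
apply: standardP => [|x y x0 y0]; first by case: (v) v0.
case/cat_eqP => [[z [xvz wzy]]|[z [vxz ->]]]; last first.
  have [->//|z0] := eqVneq z [::]; apply: wlt_catr.
    by rewrite vxz size_cat leq_addl.
  by rewrite vxz standard_suffix // -vxz.
have [z0|z0] := eqVneq z [::]; first by rewrite wzy z0 -{1}[y]/([::] ++ y) -z0 -wzy.
by apply: wlt_trans wvw; rewrite wzy standard_suffix // -wzy.
Qed.

Lemma nstandard_erase t : nstandard t -> standard (erase t).
Proof. by case: t => [i|t1 t2] /= /andP[]. Qed.

Lemma erase_neq0 t : erase t != [::].
Proof. by elim: t => //= t1 IH t2 _; case: erase IH. Qed.

Lemma nstandard_bracket t1 t2 : nstandard (NBracket t1 t2) ->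
  [/\ nstandard t1, nstandard t2, wlt (erase t2) (erase t1 ++ erase t2)
    & wlt (erase t2) (erase t1)].
Proof.
case/andP=> /= st /and3P[st1 st2 _].
have lt := standard_suffix st (erase_neq0 _) (erase_neq0 _).
by split=> //; apply: wlt_trans lt _; rewrite wlt_prefix erase_neq0.
Qed.

Lemma standard_nbracket t1 t2 : nstandard t1 -> nstandard t2 ->
  wlt (erase t2) (erase t1) ->
  (forall t11 t12, t1 = NBracket t11 t12 -> wle (erase t12) (erase t2)) ->
  nstandard (NBracket t1 t2).
Proof.
move=> st1 st2 lt21 H; apply/andP; split.
  by apply: standard_cat => //; apply: nstandard_erase.
apply/and3P; split=> //.
by case: t1 H {st1 lt21} => // t11 t12 /(_ _ _ erefl).
Qed.

(** The greatest nonempty ending of [u] is standard, because its own endings are endings of [u] as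
    well. *)
Lemma max_suffix u : u != [::] ->
  exists x y, [/\ u = x ++ y, standard y & wle u y].
Proof.
move=> u0; suff [x [y [uxy y0 ymax]]] : exists x y, [/\ u = x ++ y, y != [::] &
    forall s z, z != [::] -> u = s ++ z -> wle z y].
  exists x, y; split; [by []| |exact: (ymax [::])].
  apply: standardP => // s z s0 z0 ysz.
  have : wle z y by apply: (ymax (x ++ s)) => //; rewrite -catA -ysz.
  case/orP=> // /eqP zy.
  move/(congr1 size)/eqP: ysz; rewrite -zy size_cat -{1}[size z]add0n eqn_add2r.
  by rewrite eq_sym size_eq0 (negPf s0).
elim: u u0 => // i u IH _; have [u0|/IH[x [y [uxy y0 ymax]]]] := eqVneq u [::].
  exists [::], [:: i]; rewrite u0; split=> //.
  by case=> [|j [|? ?]] [|k [|? ?]] //= _ [->]; rewrite wlexx.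
have [iu_y|y_iu] := boolP (wle (i :: u) y).
  exists (i :: x), y; split=> //; first by rewrite uxy.
  by case=> [|j s] z z0; [move=> /= <- | case=> _; apply: ymax].
exists [::], (i :: u); split=> // -[|j s] z z0 iuE; first by rewrite iuE wlexx.
apply: wltW; rewrite -wltNge in y_iu; apply: wle_wlt_trans y_iu.
by case: iuE => _; apply: ymax.
Qed.

(* If not, [z = y t2] with [y] a proper suffix of [t1]. The greatest suffix of
   [y] is a standard suffix of [t1], so by induction a suffix of [t12]; hence
   [y <= t12 <= t2], which contradicts [z > t2]. *)
Lemma nstandard_right_longest t1 t2 s z : nstandard (NBracket t1 t2) ->
  s != [::] -> standard z -> erase t1 ++ erase t2 = s ++ z ->
  (size z <= size (erase t2))%N.
Proof.
elim: t1 t2 s z => [i|t11 IH t12 _] t2 s z st12 s0 stz.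
  case: s s0 => // j s _ [_]; case: s => [|k s] /= ->;
    by rewrite /= ?size_cat ?leqW ?leq_addl.
have [st1 st2 _ _] := nstandard_bracket st12.
have le2 : wle (erase t12) (erase t2) by case/andP: st12 => _ /and3P[].
have stt12 := nstandard_erase st2.
case/cat_eqP => [[y [_ ->]]|[y [t1sy zyt2]]]; first by rewrite size_cat leq_addl.
have [y0|y0] := eqVneq y [::]; first by rewrite zyt2 y0.
have [x [x' [yxx' stx' yx']]] := max_suffix y0.
have sx'_t12 : (size x' <= size (erase t12))%N.
  apply: (IH t12 (s ++ x) x') => //; first by case: (s) s0.
  by rewrite -catA -yxx'.
have le_x' : wle x' (erase t12).
  have /cat_eqP : erase t11 ++ erase t12 = (s ++ x) ++ x' by rewrite -catA -yxx'.
  case=> [[y' [_ t12E]]|[y' [_ x'E]]]; last first.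
    move: sx'_t12; rewrite x'E size_cat -{2}[size (erase t12)]add0n leq_add2r.
    by rewrite leqn0 size_eq0 => /eqP->; rewrite wlexx.
  have [y'0|y'0] := eqVneq y' [::]; first by rewrite t12E y'0 wlexx.
  apply: wltW; rewrite t12E standard_suffix //.
    by rewrite -t12E; apply/nstandard_erase; case: (nstandard_bracket st1).
  exact: standard_neq0.
have: wlt (erase t2) z by rewrite zyt2 standard_suffix ?erase_neq0 // -zyt2.
rewrite wltNge zyt2; case/negP; apply: wltW.
have := wle_trans (wle_trans yx' le_x') le2.
by apply: wlt_wle_trans; rewrite wlt_prefix erase_neq0.
Qed.

(** Uniqueness in Shirshov's theorem: the right half of a standard bracketing is the longest
    standard proper ending, so the word determines where it is cut. *)
Lemma erase_inj t t' : nstandard t -> nstandard t' -> erase t = erase t' -> t = t'.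
Proof.
elim: t t' => [i|t1 IH1 t2 IH2] [j|t1' t2'] st st'; first by case=> ->.
- have := erase_neq0 t1'; have := erase_neq0 t2' => /=.
  by case: (erase t1') => // ? []; case: (erase t2').
- have := erase_neq0 t1; have := erase_neq0 t2 => /=.
  by case: (erase t1) => // ? []; case: (erase t2).
move=> /= e12.
have [st1 st2 _ _] := nstandard_bracket st.
have [st1' st2' _ _] := nstandard_bracket st'.
have sz : size (erase t2) = size (erase t2').
  apply/eqP; rewrite eqn_leq.
  rewrite (nstandard_right_longest st' _ _ (esym e12)) ?erase_neq0 //;
    last exact: nstandard_erase.
  by rewrite (nstandard_right_longest st _ _ e12) ?erase_neq0 ?nstandard_erase.
have sz1 : size (erase t1) = size (erase t1').
  by have/(congr1 size)/eqP := e12; rewrite !size_cat sz eqn_add2r => /eqP.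
by move/eqP: e12; rewrite eqseq_cat // => /andP[/eqP/IH1-> // /eqP/IH2->].
Qed.

End Words.

(** * Skew commutators *)

Section SkewCommutator.
Variables (K : fieldType) (G : zmodType) (lambda : G -> G -> K).
Hypothesis lambda_bichar : bicharacter lambda.
Implicit Types (al be ga : (nat * G)%type).

Definition skewp al be : K := (lambda be.2 al.2)^-1.

Lemma bichar0l h : lambda 0 h = 1.
Proof.
apply: (mulfI (bichar_neq0 lambda_bichar 0 h)).
by rewrite -bicharDl // addr0 mulr1.
Qed.

Lemma bichar0r h : lambda h 0 = 1.
Proof.
apply: (mulfI (bichar_neq0 lambda_bichar h 0)).
by rewrite -bicharDr // addr0 mulr1.
Qed.

Lemma skewpDl al al' be : skewp (al + al') be = skewp al be * skewp al' be.
Proof. by rewrite /skewp bicharDr // invfM. Qed.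

Lemma skewpDr al be be' : skewp al (be + be') = skewp al be * skewp al be'.
Proof. by rewrite /skewp bicharDl // invfM. Qed.

Lemma skewp0r al : skewp al 0 = 1.
Proof. by rewrite /skewp bichar0l invr1. Qed.

Variable A : algType K.
Implicit Types x y z : A.

Definition sbracket al be x y := x * y - skewp al be *: (y * x).

Lemma sbracket_linear al be x : linear (sbracket al be x).
Proof.
move=> c y z; rewrite /sbracket mulrDr mulrDl -scalerAr -scalerAl.
by rewrite scalerDr scalerBr !scalerA opprD addrACA mulrC.
Qed.

(** Skew Leibniz rule; it carries a bracket through a super-word letter by letter. *)
Lemma sbracketM al be ga x y z :
  sbracket al (be + ga) x (y * z)
  = sbracket al be x y * z + skewp al be *: (y * sbracket al ga x z).
Proof.
rewrite /sbracket skewpDr mulrBl mulrBr scalerBr -!scalerAl -!scalerAr scalerA.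
by rewrite !mulrA addrA subrK.
Qed.

(** The two correction terms carry different coefficients and in general do not combine into a
    bracket, so they are treated as products of [[x, z]] and [y]. *)
Lemma sbracket_jacobi al be ga x y z :
  sbracket (al + be) ga (sbracket al be x y) z
  = sbracket al (be + ga) x (sbracket be ga y z)
    + (skewp be ga *: (sbracket al ga x z * y)
       - skewp al be *: (y * sbracket al ga x z)).
Proof.
rewrite /sbracket skewpDl skewpDr !(mulrBl, mulrBr, scalerBr) -?scalerAl -?scalerAr.
rewrite -?(scalerAl,scalerAr) !(scalerBr, scalerA) !mulrA !opprB !addrA.
rewrite [RHS](ACl (1*8*3*6*(2*5)*(4*7)))/= !addNr !addr0.
by congr (_ - _ + _ *: _ - _ *: _); rewrite mulrC ?mulrA.
Qed.
End SkewCommutator.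

(** * Superwords *)

Section Superletters.
Variable n : nat.
Implicit Types (s t : superletter n).

Lemma sl_word_inj : injective (@sl_word n).
Proof. by move=> s t /(erase_inj (valP s) (valP t))/val_inj. Qed.

Lemma sl_ltxx t : sl_lt t t = false.
Proof. exact: wltxx. Qed.

Lemma sl_lt_trans : transitive (@sl_lt n).
Proof. by move=> s t u; apply: wlt_trans. Qed.

Lemma sl_word_neq0 t : sl_word t != [::].
Proof. exact: erase_neq0. Qed.

Definition sl_le s t := wle (sl_word s) (sl_word t).

Lemma sl_leE s t : sl_le s t = (s == t) || sl_lt s t.
Proof. by rewrite /sl_le /wle (inj_eq sl_word_inj). Qed.

Lemma sl_ltNge s t : sl_lt s t = ~~ sl_le t s.
Proof. exact: wltNge. Qed.

Lemma sl_le_trans : transitive sl_le.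
Proof. by move=> s t u; apply: wle_trans. Qed.

Lemma sl_lexx t : sl_le t t.
Proof. exact: wlexx. Qed.

Lemma sl_le_anti : antisymmetric sl_le.
Proof.
move=> s t; rewrite sl_leE => /andP[/orP[/eqP//|st]].
by move: st; rewrite sl_ltNge => /negP.
Qed.

Lemma sl_ltW s t : sl_lt s t -> sl_le s t.
Proof. exact: wltW. Qed.

Lemma sl_lt_neqAle s t : sl_lt s t = (s != t) && sl_le s t.
Proof.
by rewrite sl_leE; have [->|//] := eqVneq s t; rewrite sl_ltxx.
Qed.

End Superletters.

(** * Brackets of super-letters as combinations of super-words *)

Section Reordering.
Variables (K : fieldType) (G : zmodType) (lambda : G -> G -> K).
Hypothesis lambda_bichar : bicharacter lambda.
Variables (H : algType K) (n : nat) (a : 'I_n -> H) (g : 'I_n -> G).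
Variable d : 'I_n -> nat.
Hypothesis d_gt0 : forall i, (0 < d i)%N.
Local Notation ev := (sw_eval lambda g a).
Local Notation nev := (nword_eval lambda g a).
Local Notation br := (sbracket lambda).
Implicit Types (u v w : seq 'I_n) (t : superletter n) (W X Y : superword n).
Implicit Types (al be ga : (nat * G)%type).

(** The grade determines the skew coefficients and the degree controls the reduction; as a pair they
    form one additive invariant. *)
Definition word_weight u : (nat * G)%type := (wdeg d u, wgrade g u).

Definition sw_weight W : (nat * G)%type :=
  \sum_(t <- W) word_weight (sl_word t).

Lemma word_weight_cat u v : word_weight (u ++ v) = word_weight u + word_weight v.
Proof. by rewrite /word_weight /wdeg /wgrade !big_cat. Qed.

Lemma sw_weight_cons t W :
  sw_weight (t :: W) = word_weight (sl_word t) + sw_weight W.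
Proof. exact: big_cons. Qed.

Lemma sw_weight_nil : sw_weight [::] = 0.
Proof. exact: big_nil. Qed.

Lemma sw_weight_seq1 t : sw_weight [:: t] = word_weight (sl_word t).
Proof. exact: big_seq1. Qed.

Lemma sw_weight_cat W X : sw_weight (W ++ X) = sw_weight W + sw_weight X.
Proof. exact: big_cat. Qed.

Lemma sw_weight_deg W : (sw_weight W).1 = sw_deg d W.
Proof.
elim: W => [|t W IH]; first by rewrite sw_weight_nil /sw_deg big_nil.
by rewrite sw_weight_cons /sw_deg big_cons -[(\sum_(j <- W) _)%N]IH.
Qed.

Lemma wdeg_gt0 u : u != [::] -> (0 < wdeg d u)%N.
Proof. by case: u => // i u _; rewrite /wdeg big_cons addn_gt0 d_gt0. Qed.

Lemma sw_deg_cat W X : sw_deg d (W ++ X) = (sw_deg d W + sw_deg d X)%N.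
Proof. exact: big_cat. Qed.

Lemma sw_deg_gt0 W : (0 < sw_deg d W)%N = (W != [::]).
Proof.
case: W => [|t W]; first by rewrite /sw_deg big_nil.
by rewrite /sw_deg big_cons addn_gt0 wdeg_gt0 ?sl_word_neq0.
Qed.

Lemma ev_nil : ev [::] = 1.
Proof. exact: big_nil. Qed.

Lemma ev_cat W X : ev (W ++ X) = ev W * ev X.
Proof. exact: big_cat. Qed.

Lemma ev_cons t W : ev (t :: W) = sl_eval lambda g a t * ev W.
Proof. exact: big_cons. Qed.

Lemma ev_seq1 t : ev [:: t] = sl_eval lambda g a t.
Proof. exact: big_seq1. Qed.

Definition sw_span (b : pred (superletter n)) al W := sw_weight W = al /\ all b W.

Lemma span_mono (b b' : pred (superletter n)) al x : (forall t, b t -> b' t) ->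
  lincomb (sw_span b al) ev x -> lincomb (sw_span b' al) ev x.
Proof.
by move=> bb'; apply: lincomb_mono => W [Wal Wb]; split=> //; apply: sub_all Wb.
Qed.

Lemma spanM b al be x y : lincomb (sw_span b al) ev x ->
  lincomb (sw_span b be) ev y -> lincomb (sw_span b (al + be)) ev (x * y).
Proof.
apply: lincombM => W X [Wal Wb] [Xbe Xb]; rewrite -ev_cat; apply: lincomb_gen.
by split; [rewrite sw_weight_cat Wal Xbe | rewrite all_cat Wb].
Qed.

Lemma nev_bracket (t1 t2 : nword n) : nev (NBracket t1 t2) =
  br (word_weight (erase t1)) (word_weight (erase t2)) (nev t1) (nev t2).
Proof. by []. Qed.

Lemma span_nev (b : pred (superletter n)) (t : nword n) (st : nstandard t) :
  b (exist _ t st) -> lincomb (sw_span b (word_weight (erase t))) ev (nev t).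
Proof.
move=> bt; rewrite -[nev t]/(sl_eval lambda g a (exist _ t st)) -ev_seq1.
by apply: lincomb_gen; split; rewrite /= ?sw_weight_seq1 ?bt.
Qed.

Lemma span_br (b : pred (superletter n)) al x X : all b X ->
  (forall t, t \in X -> lincomb (sw_span b (al + word_weight (sl_word t))) ev
     (br al (word_weight (sl_word t)) x (sl_eval lambda g a t))) ->
  lincomb (sw_span b (al + sw_weight X)) ev (br al (sw_weight X) x (ev X)).
Proof.
elim: X => [|t X IH] /= => [_ _|/andP[bt bX] Hx].
  rewrite /sbracket /sw_eval big_nil sw_weight_nil skewp0r // scale1r mulr1 mul1r.
  by rewrite subrr; apply: lincomb0.
rewrite sw_weight_cons ev_cons sbracketM //; apply: lincombD.
  rewrite addrA; apply: spanM; first by apply: Hx; rewrite mem_head.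
  exact: lincomb_gen.
apply: lincombZ; rewrite addrCA; apply: spanM.
  by rewrite -ev_seq1; apply: lincomb_gen; split; rewrite ?sw_weight_seq1 //= bt.
by apply: IH => // s sX; apply: Hx; rewrite inE sX orbT.
Qed.

(* If [t1 = [v1 v2]] with [v2 > w], the bracketing [[v1 v2] w] is not standard,
   and the skew Jacobi identity reduces it to brackets whose left factor is
   [v1] or [v2]. *)
Lemma span_bracket (t w : nword n) :
  nstandard t -> nstandard w -> wlt (erase w) (erase t) ->
  lincomb (sw_span (fun s => wle (sl_word s) (erase t ++ erase w))
             (word_weight (erase t) + word_weight (erase w)))
    ev (br (word_weight (erase t)) (word_weight (erase w)) (nev t) (nev w)).
Proof.
elim: t w => [i|t1 IH1 t2 IH2] w stt stw ltwt.
  rewrite -nev_bracket -word_weight_cat.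
  have st : nstandard (NBracket (NLetter i) w) by apply: standard_nbracket.
  by apply: (span_nev (st := st)); apply: wlexx.
have [le2w|] := boolP (wle (erase t2) (erase w)).
  rewrite -nev_bracket -word_weight_cat.
  have st : nstandard (NBracket (NBracket t1 t2) w).
    by apply: standard_nbracket => // t11 t12 [_ <-].
  by apply: (span_nev (st := st)); apply: wlexx.
rewrite -wltNge => ltw2; have [st1 st2 lt2 lt21] := nstandard_bracket stt.
have t20 := erase_neq0 t2.
have lt2w : wlt (erase t2 ++ erase w) ((erase t1 ++ erase t2) ++ erase w).
  by apply: wlt_catr => //; rewrite size_cat leq_addl.
have ltw1 : wlt (erase w) (erase t1) by apply: wlt_trans lt21.
have lt1w : wlt (erase t1 ++ erase w) ((erase t1 ++ erase t2) ++ erase w).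
  rewrite -catA wlt_cat2l wlt_cat_standard //; exact: nstandard_erase.
rewrite nev_bracket [erase (NBracket _ _)]/= word_weight_cat sbracket_jacobi //.
apply: lincombD; last first.
  have H1 := IH1 w st1 stw ltw1.
  have {}H1 : lincomb (sw_span
      (fun s => wle (sl_word s) ((erase t1 ++ erase t2) ++ erase w))
      (word_weight (erase t1) + word_weight (erase w))) ev
      (br (word_weight (erase t1)) (word_weight (erase w)) (nev t1) (nev w)).
    by apply: span_mono H1 => s /wle_trans; apply; apply: wltW.
  have H2 : lincomb (sw_span
      (fun s => wle (sl_word s) ((erase t1 ++ erase t2) ++ erase w))
      (word_weight (erase t2))) ev (nev t2).
    apply: (span_nev (st := st2)); apply: wltW.
    by rewrite -[X in wlt X _]cats0 wlt_catr // size_cat leq_addl.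
  apply: lincombB; apply: lincombZ.
    by rewrite addrAC; apply: spanM.
  by rewrite addrAC [X in sw_span _ X]addrC; apply: spanM.
(* A letter s in the expansion of [v2 w] is at most v2 w, which is less than v2 < v1. So the
   induction hypothesis for v1 applies to [v1 s], whose letters are at most v1 s and hence at most
   v1 v2 w. *)
move: (IH2 w st2 stw ltw2); rewrite -addrA.
apply: lincomb_linear => [|X [Xal Xb]]; first exact: sbracket_linear.
rewrite -Xal; apply: span_br => [|s sX].
  by apply: sub_all Xb => s /wle_trans; apply; apply: wltW.
have les : wle (sl_word s) (erase t2 ++ erase w) := allP Xb s sX.
have lts : wlt (sl_word s) (erase t1).
  apply: wle_wlt_trans les (wlt_trans _ lt21).
  by rewrite wlt_prefix erase_neq0.
apply: span_mono (IH1 (val s) st1 (valP s) lts) => x /wle_trans; apply.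
by rewrite -catA wle_cat2l.
Qed.

End Reordering.

(** * Gaussian binomial coefficients *)

(** Gaussian binomials by recursion, since the quotient formula breaks down at roots of unity. The
    power of q stands where right multiplication by [[u] (x) 1] produces it. *)
Fixpoint qbin (R : pzRingType) (q : R) (m k : nat) : R :=
  match m, k with
  | _, 0 => 1
  | 0, _.+1 => 0
  | m'.+1, k'.+1 => qbin q m' k + q ^+ (m' - k') * qbin q m' k'
  end.

Lemma qbin_small (R : pzRingType) (q : R) m k : (m < k)%N -> qbin q m k = 0.
Proof.
elim: m k => [|m IH] [|k] //= mk.
by rewrite (IH k.+1 (ltnW mk)) (IH k mk) mulr0 addr0.
Qed.

Lemma qbinn (R : pzRingType) (q : R) m : qbin q m m = 1.
Proof.
by elim: m => //= m IH; rewrite qbin_small // subnn mul1r add0r.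
Qed.

(** The coproduct yields q = lambda(g_u, g_u), whereas heights are defined through its inverse
    p_uu. *)
Lemma prim_rootV (F : fieldType) (z : F) t :
  t.-primitive_root z -> t.-primitive_root z^-1.
Proof.
case/andP=> t0 /forallP zt; apply/andP; split=> //; apply/forallP=> i.
by rewrite -(eqP (zt i)) !unity_rootE exprVn invr_eq1.
Qed.

Section QBinomials.
Variables (K : fieldType) (q : K).
Local Notation P m := (\prod_(i < m) (1 + q ^+ i *: 'X) : {poly K}).

Lemma qbin0 m : qbin q m 0 = 1.
Proof. by case: m. Qed.

(** Gauss's q-binomial theorem. It turns vanishing of Gaussian binomials into vanishing of
    coefficients of a product that simplifies at roots of unity. *)
Lemma gauss_binomial m k : (P m)`_k = q ^+ 'C(k, 2) * qbin q m k.
Proof.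
elim: m k => [|m IH] k.
  by rewrite big_ord0 coef1; case: k => [|k] /=; rewrite ?mulr0 ?mul1r.
rewrite big_ord_recr /= mulrDr mulr1 coefD -scalerAr coefZ coefMX IH.
case: k => [|k] /=; first by rewrite mulr0 addr0; case: (m).
rewrite IH mulrDr; congr (_ + _).
have [mk|km] := ltnP m k; first by rewrite qbin_small // !mulr0.
by rewrite !mulrA -!exprD binS bin1; congr (_ ^+ _ * _); lia.
Qed.

(** X^t - 1 is the product of the X - q^(-i). Substituting -X and multiplying each factor by -q^i
    gives 1 + q^i X. *)
Lemma prod_prim_root t : t.-primitive_root q -> P t = 1 - (- 'X) ^+ t.
Proof.
move=> qt; have t0 := prim_order_gt0 qt.
have q0 : q != 0 by apply: contra_eq_neq (prim_expr_order qt) => ->;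
  rewrite expr0n gtn_eqF // eq_sym oner_neq0.
have qVt := prim_rootV qt.
have E : P t = (\prod_(i < t) - (q ^+ i))%:P * ((- 'X) ^+ t - 1).
  have -> : (- 'X) ^+ t - 1 = ('X^t - 1) \Po (- 'X) :> {poly K}.
    by rewrite rmorphB rmorph1 /= rmorphXn /= comp_polyX.
  rewrite -(factor_Xn_sub_1 qVt) big_mkord rmorph_prod rmorph_prod -big_split /=.
  apply: eq_bigr => i _; rewrite comp_polyB comp_polyX comp_polyC.
  rewrite mulrBr polyCN mulrNN mulNr opprK mul_polyC -polyCM.
  rewrite exprVn mulfV ?expf_neq0 //.
  by rewrite addrC.
(* Comparing constant terms shows that the product of the scalars -q^i is -1. *)
have := congr1 (fun p : {poly K} => p`_0) E.
rewrite gauss_binomial coefCM coefB coef1 /=.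
rewrite -horner_coef0 horner_exp hornerN hornerX oppr0 expr0n gtn_eqF //.
rewrite sub0r mulrN1 qbin0 mulr1 expr0 => c1.
by rewrite E -[\prod_(i < _) _]opprK -c1 polyCN mulNr mul1r opprB.
Qed.

Lemma prod_prim_rootM t N : t.-primitive_root q -> P (t * N) = (1 - (- 'X) ^+ t) ^+ N.
Proof.
move=> qt; elim: N => [|N IH]; first by rewrite muln0 big_ord0.
rewrite mulnS addnC big_split_ord /= IH exprSr -(prod_prim_root qt).
congr (_ * _); apply: eq_bigr => i _; congr (1 + _ *: _).
by rewrite exprD exprM (prim_expr_order qt) expr1n mul1r.
Qed.

Lemma coef_binomial_power (c : K) M N : (0 < M)%N ->
  ((1 + c *: 'X^M) ^+ N : {poly K})`_M = N%:R * c.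
Proof.
move=> M0; elim: N => [|N IH]; first by rewrite coef1 gtn_eqF // mul0r.
rewrite exprSr mulrDr mulr1 coefD IH -scalerAr coefZ coefMXn ltnn subnn.
rewrite -horner_coef0 horner_exp hornerD hornerZ hornerXn hornerC.
by rewrite expr0n gtn_eqF // mulr0 addr0 expr1n mulr1 -natr1 mulrDl mul1r.
Qed.

(** [B] is the full power of the characteristic in [N], or 1 in characteristic zero. Thus (1 + Y)^B
    = 1 + Y^B, while [M] remains nonzero in the field. *)
Lemma pchar_part N : (0 < N)%N -> exists B M,
  [/\ N = (B * M)%N, ([pchar K]).-nat B, M%:R != 0 :> K
    & B = 1%N \/ exists l k, l \in [pchar K] /\ B = (l ^ k)%N].
Proof.
move=> N0; have [[l lK]|noK] := pselect (exists l, l \in [pchar K]).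
  exists (l ^ logn l N)%N, (N %/ l ^ logn l N)%N.
  have dvd : (l ^ logn l N %| N)%N := pfactor_dvdnn _ _.
  split; [by rewrite mulnC divnK| |rewrite -(dvdn_pcharf lK)|].
  - by rewrite pnatX pnatE ?lK // (pcharf_prime lK).
  - have := pfactor_dvdn (logn l N).+1 (pcharf_prime lK) N0.
    rewrite ltnn => /negbT; apply: contra => lM.
    by rewrite expnS -[N in (_ %| N)%N](divnK dvd) dvdn_mul.
  - by right; exists l, (logn l N).
exists 1%N, N; rewrite mul1n; split=> //; last by left.
by apply/eqP => /eqP/(natf0_pchar N0).
Qed.

(** Vanishing at k = 1 gives q^m = 1, so m = tBM with t the order of q and B, M as in [pchar_part].
    The product is then (1 + c^B X^(tB))^M, whose coefficient at tB is M c^B, which is nonzero. For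
    M > 1 this is one of the coefficients assumed to vanish. *)
Lemma qbin_vanish m : (1 < m)%N ->
  (forall k, (0 < k < m)%N -> qbin q m k = 0) ->
  exists2 t, t.-primitive_root q &
    m = t \/ exists l k, l \in [pchar K] /\ m = (t * l ^ k)%N.
Proof.
move=> m1 qm; have m0 := ltnW m1.
have qm1 : q ^+ m = 1.
  apply/eqP; rewrite -subr_eq0 subrX1.
  suff <- : qbin q m 1 = \sum_(i < m) q ^+ i by rewrite qm ?m1 // mulr0.
  elim: (m) => [|j IH]; first by rewrite big_ord0.
  by rewrite big_ord_recr /= -IH subn0; case: (j) => [|j']; rewrite /= mulr1.
have [t qt /dvdnP[N mE]] := prim_order_exists m0 qm1.
have t0 := prim_order_gt0 qt.
have N0 : (0 < N)%N by move: m0; rewrite mE muln_gt0 => /andP[].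
have [B [M [NE charB M0 BE]]] := pchar_part N0.
have B0 : (0 < B)%N by move: N0; rewrite NE muln_gt0 => /andP[].
exists t => //.
suff M1 : M = 1%N.
  move: mE; rewrite NE M1 muln1 mulnC; case: BE => [->|[l [k [lK ->]]]].
    by rewrite muln1; left.
  by right; exists l, k.
have M0' : (0 < M)%N by rewrite lt0n; apply: contraNneq M0 => ->.
apply/eqP; rewrite eqn_leq M0' andbT leqNgt; apply/negP => M1.
(* Chosen so that 1 - (-X)^t = 1 + c X^t. *)
pose c : K := - (-1) ^+ t.
have PE : P m = (1 + (c ^+ B) *: 'X^(t * B)) ^+ M.
  rewrite mE mulnC (prod_prim_rootM N qt) NE exprM; congr (_ ^+ M).
  rewrite exprDn_pchar; last first.
    by rewrite (eq_pnat _ (@pchar_poly K)).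
  rewrite expr1n; congr (_ + _).
  by rewrite -[- 'X]scaleN1r exprZn -scaleNr exprZn -exprM.
have := gauss_binomial m (t * B); rewrite PE coef_binomial_power ?muln_gt0 ?t0 //.
rewrite qm ?mulr0; last first.
  by rewrite muln_gt0 t0 B0 mE NE; nia.
apply/eqP; rewrite mulf_neq0 // expf_neq0 // oppr_eq0 expf_neq0 //.
by rewrite oppr_eq0 oner_neq0.
Qed.
End QBinomials.

(** * Coproducts of superwords *)

Section Coproduct.
Variables (K : fieldType) (G : zmodType) (lambda : G -> G -> K).
Hypothesis lambda_bichar : bicharacter lambda.
Variables (H : algType K) (S : graded_hopf lambda H).
Variables (n : nat) (a : 'I_n -> H) (g : 'I_n -> G) (d : 'I_n -> nat).
Hypothesis d_gt0 : forall i, (0 < d i)%N.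
Hypothesis a_homog : forall i, a i \in grading S (g i).
Hypothesis a_prim : forall i, primitive_elt S (a i).
Local Notation ev := (sw_eval lambda g a).
Local Notation nev := (nword_eval lambda g a).
Local Notation br := (sbracket lambda).
Local Notation ww := (word_weight g d).
Local Notation sww := (sw_weight g d).
Local Notation tn := (tens (tHH S)).
Implicit Types (t u : superletter n) (W X Y V : superword n).
Implicit Types (al be ga : (nat * G)%type) (x y z : H).
Implicit Types (h b : pred (superletter n)) (nz : bool).

Lemma tens_linearl y : linear (tn^~ y).
Proof. by have [/(_ y)] := tens_bilinear (tHH S). Qed.

Lemma tens_linearr x : linear (tn x).
Proof. by have [_ /(_ x)] := tens_bilinear (tHH S). Qed.

Lemma tensZl c x y : tn (c *: x) y = c *: tn x y.
Proof.
have t0 : tn 0 y = 0.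
  by have := tens_linearl y (-1) 0 0; rewrite scaler0 add0r scaleN1r addNr.
by have := tens_linearl y c x 0; rewrite /= !addr0 t0 addr0.
Qed.

Lemma tensDl x x' y : tn (x + x') y = tn x y + tn x' y.
Proof. by have := tens_linearl y 1 x x'; rewrite /= !scale1r. Qed.

Lemma tensBl x x' y : tn (x - x') y = tn x y - tn x' y.
Proof. by rewrite tensDl -[- x']scaleN1r tensZl scaleN1r. Qed.

Lemma tensZr c x y : tn x (c *: y) = c *: tn x y.
Proof.
have t0 : tn x 0 = 0.
  by have := tens_linearr x (-1) 0 0; rewrite scaler0 add0r scaleN1r addNr.
by have := tens_linearr x c y 0; rewrite /= !addr0 t0 addr0.
Qed.

Lemma tensDr x y y' : tn x (y + y') = tn x y + tn x y'.
Proof. by have := tens_linearr x 1 y y'; rewrite /= !scale1r. Qed.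

Lemma tensBr x y y' : tn x (y - y') = tn x y - tn x y'.
Proof. by rewrite tensDr -[- y']scaleN1r tensZr scaleN1r. Qed.

(** 1 has grade 0, so multiplying by [tn 1 1] on the left involves no twist and fixes every pure
    tensor. The first factor is split into homogeneous parts because the twisted product is given
    only for homogeneous inner factors. *)
Lemma tens11 : tn 1 1 = 1.
Proof.
have unit_l (z : HH S) : tn 1 1 * z = z.
  pose f (z : HH S) : HH S := tn 1 1 * z.
  have lin_f : linear f by move=> c x y; rewrite /f mulrDr -scalerAr.
  have lin_id : linear (id : HH S -> HH S) by [].
  apply: (tens_ext (t0 := tHH S) lin_f lin_id) => {z} x y; rewrite /f.
  have [s [c [cgr ->]]] := dsum_span (grading_dsum S) x.
  apply: (big_ind (fun x => tn 1 1 * tn x y = tn x y)) => [|x1 x2 H1 H2|h _].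
  - by rewrite -(scale0r 0) tensZl scale0r mulr0.
  - by rewrite !tensDl mulrDr H1 H2.
  - by rewrite (tHH_mul _ _ (grading1 S) (cgr h)) bichar0l // scale1r !mul1r.
by rewrite -[LHS]mulr1 unit_l.
Qed.

Lemma gradingB (h : G) x y :
  x \in grading S h -> y \in grading S h -> x - y \in grading S h.
Proof.
move=> xh yh; have [_ lin] := dsum_submod (grading_dsum S) h.
by rewrite addrC -scaleN1r; apply: lin.
Qed.

Lemma gradingZ (h : G) c x : x \in grading S h -> c *: x \in grading S h.
Proof.
move=> xh; have [h0 lin] := dsum_submod (grading_dsum S) h.
by rewrite -[c *: x]addr0; apply: lin.
Qed.

Lemma nev_homog (t : nword n) : nev t \in grading S (wgrade g (erase t)).
Proof.
elim: t => [i|t1 IH1 t2 IH2] /=; first by rewrite /wgrade big_seq1.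
have -> : wgrade g (erase t1 ++ erase t2) = wgrade g (erase t1) + wgrade g (erase t2).
  exact: big_cat.
apply: gradingB; first exact: gradingM.
by apply: gradingZ; rewrite addrC; apply: gradingM.
Qed.

Lemma ev_homog W : ev W \in grading S (sww W).2.
Proof.
elim: W => [|t W IH]; first by rewrite /sw_eval /sw_weight !big_nil grading1.
by rewrite ev_cons sw_weight_cons; apply: gradingM => //; apply: nev_homog.
Qed.

Definition ev2 (WX : superword n * superword n) : HH S := tn (ev WX.1) (ev WX.2).

Lemma ev2M W X W' X' : ev2 (W, X) * ev2 (W', X') =
  lambda (sww X).2 (sww W').2 *: ev2 (W ++ W', X ++ X').
Proof. by rewrite /ev2 /= !ev_cat (tHH_mul _ _ (ev_homog X) (ev_homog W')). Qed.

(** With [h = predT] and [nz = true] the condition says that the left factor is not the empty word.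
    The right factor is constrained by its weight only. *)
Definition tspan h b nz al (WX : superword n * superword n) : Prop :=
  [/\ nz ==> has h WX.1, all b WX.1 & sww WX.1 + sww WX.2 = al].

Lemma tspan_mono h b nz h' b' nz' al (x : HH S) :
  (forall t, h t -> h' t) -> (forall t, b t -> b' t) -> (nz' -> nz) ->
  lincomb (tspan h b nz al) ev2 x -> lincomb (tspan h' b' nz' al) ev2 x.
Proof.
move=> hh' bb' nn'; apply: lincomb_mono => -[W X] [/= Wh Wb wal]; split=> //=.
  by apply/implyP=> /nn' nzT; move: Wh; rewrite nzT; apply: sub_has.
exact: sub_all Wb.
Qed.

Lemma tspanM h b nz nz' al be (x y : HH S) : lincomb (tspan h b nz al) ev2 x ->
  lincomb (tspan h b nz' be) ev2 y ->
  lincomb (tspan h b (nz || nz') (al + be)) ev2 (x * y).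
Proof.
apply: lincombM => -[W X] [W' X'] [/= hW bW <-] [/= hW' bW' <-].
rewrite ev2M; apply/lincombZ/lincomb_gen; split=> /=.
- rewrite has_cat; apply/implyP=> /orP[/(implyP hW)->//|/(implyP hW')->].
  by rewrite orbT.
- by rewrite all_cat bW.
- by rewrite !sw_weight_cat addrACA.
Qed.

Lemma tspan_br h b nz nz' al be (x y : HH S) : lincomb (tspan h b nz al) ev2 x ->
  lincomb (tspan h b nz' be) ev2 y ->
  lincomb (tspan h b (nz || nz') (al + be)) ev2 (br al be x y).
Proof.
move=> Hx Hy; apply: lincombB; first exact: tspanM.
by apply: lincombZ; rewrite orbC addrC; apply: tspanM.
Qed.

Lemma tspan_tensl (b : pred (superletter n)) (t : nword n) (st : nstandard t) :
  b (exist _ t st) -> lincomb (tspan predT b true (ww (erase t))) ev2 (tn (nev t) 1).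
Proof.
move=> bt; have -> : tn (nev t) 1 = ev2 ([:: exist _ t st], [::]).
  by rewrite /ev2 /= ev_seq1 ev_nil.
apply: lincomb_gen; split; rewrite /= ?bt //.
by rewrite sw_weight_seq1 sw_weight_nil addr0.
Qed.

Lemma tspan_tensr h b (t : nword n) (st : nstandard t) :
  lincomb (tspan h b false (ww (erase t))) ev2 (tn 1 (nev t)).
Proof.
have -> : tn 1 (nev t) = ev2 ([::], [:: exist _ t st]).
  by rewrite /ev2 /= ev_seq1 ev_nil.
apply: lincomb_gen; split; rewrite //=.
by rewrite sw_weight_seq1 sw_weight_nil add0r.
Qed.

Lemma sbracketDl (A : algType K) al be (x x' y : A) :
  br al be (x + x') y = br al be x y + br al be x' y.
Proof. by rewrite /sbracket mulrDl mulrDr scalerDr opprD addrACA. Qed.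

Lemma sbracketDr (A : algType K) al be (x y y' : A) :
  br al be x (y + y') = br al be x y + br al be x y'.
Proof. by rewrite /sbracket mulrDl mulrDr scalerDr opprD addrACA. Qed.

(** The twist from moving [ev X] past [nev t] cancels the part of the skew coefficient that belongs
    to [X], so the bracket acts on the left factor alone. *)
Lemma br_tensl_ev2 (t : nword n) W X al :
  al = sww W + sww X ->
  br (ww (erase t)) al (tn (nev t) 1) (ev2 (W, X))
  = tn (br (ww (erase t)) (sww W) (nev t) (ev W)) (ev X).
Proof.
move=> ->; rewrite /sbracket /ev2 /=.
rewrite (tHH_mul _ _ (grading1 S) (ev_homog W)) bichar0l // scale1r mul1r.
rewrite (tHH_mul _ _ (ev_homog X) (nev_homog t)) mulr1 scalerA.
rewrite tensBl tensZl skewpDr // -mulrA /skewp /= mulVf ?mulr1 //.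
exact: bichar_neq0.
Qed.

(** Since degrees are positive, the degree bound excludes that [t1] is a proper beginning of [t].
    This is why spans of tensors keep track of weights. *)
Lemma wlt_below_cat (t1 t2 : nword n) t : wlt (sl_word t) (erase t1) ->
  (wdeg d (sl_word t) <= wdeg d (erase t1))%N ->
  wlt (sl_word t) (erase t1 ++ erase t2).
Proof.
move/wltP => [[z z0 tE]|/(_ [::] (erase t2))]; last by rewrite cats0.
rewrite tE; have -> : wdeg d (erase t1 ++ z) = (wdeg d (erase t1) + wdeg d z)%N.
  exact: big_cat.
by rewrite -{2}[wdeg d (erase t1)]addn0 leq_add2l leqNgt wdeg_gt0.
Qed.

Lemma sw_deg_mem t W : t \in W -> (wdeg d (sl_word t) <= sw_deg d W)%N.
Proof. by move=> tW; rewrite /sw_deg (big_rem t tW) leq_addr. Qed.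

Lemma sww_add_deg W X al : sww W + sww X = al -> (sw_deg d W + sw_deg d X = al.1)%N.
Proof. by move=> <-; rewrite -!(sw_weight_deg g). Qed.

(** Write each of the two coproducts as x (x) 1 + 1 (x) x plus a remainder. In their bracket the
    equal-sided terms give the primitive part, [x (x) 1, 1 (x) y] vanishes, and every other term has
    a nonempty left factor in letters below the whole word. *)
Lemma Delta_nev (t : nword n) : nstandard t ->
  lincomb (tspan predT (fun s => wlt (sl_word s) (erase t)) true (ww (erase t)))
    ev2 (Delta S (nev t) - (tn (nev t) 1 + tn 1 (nev t))).
Proof.
elim: t => [i _|t1 IH1 t2 IH2 st] /=.
  by rewrite a_prim subrr; apply: lincomb0.
have [st1 st2 lt2 lt21] := nstandard_bracket st.
set b := fun s => wlt (sl_word s) (erase t1 ++ erase t2).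
set x := nev t1; set y := nev t2; set al := ww (erase t1); set be := ww (erase t2).
have Hr1 : lincomb (tspan predT b true al) ev2
    (Delta S x - (tn x 1 + tn 1 x)).
  apply: lincomb_mono (IH1 st1) => -[W X] [/= W0 Wb WX]; split=> //=.
  apply/allP => s sW; apply: wlt_below_cat; first exact: (allP Wb).
  apply: leq_trans (sw_deg_mem sW) _.
  by rewrite -[wdeg _ _]/(al.1) -(sww_add_deg WX) leq_addr.
have Hr2 := IH2 st2; rewrite -/y in Hr2.
have Hr2b : lincomb (tspan predT b true be) ev2
    (Delta S y - (tn y 1 + tn 1 y)).
  by apply: tspan_mono Hr2 => // s /wlt_trans; apply.
set r1 := Delta S x - _ in Hr1; set r2 := Delta S y - _ in Hr2 Hr2b.
have Ex : Delta S x = r1 + (tn x 1 + tn 1 x) by rewrite subrK.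
have Ey : Delta S y = r2 + (tn y 1 + tn 1 y) by rewrite subrK.
clearbody r1 r2.
have HA2 : lincomb (tspan predT b true be) ev2 (tn y 1).
  exact: (tspan_tensl (st := st2)).
have HB2 : lincomb (tspan predT b false be) ev2 (tn 1 y) by apply: tspan_tensr.
have HB1 : lincomb (tspan predT b false al) ev2 (tn 1 x) by apply: tspan_tensr.
have Hy : lincomb (tspan predT b false be) ev2 (Delta S y).
  rewrite Ey; apply: lincombD; first by apply: tspan_mono Hr2b.
  by apply: lincombD HB2; apply: tspan_mono HA2.
have AA : br al be (tn x 1) (tn y 1) = tn (br al be x y) 1.
  rewrite /sbracket (tHH_mul _ _ (grading1 S) (nev_homog t2)).
  rewrite (tHH_mul _ _ (grading1 S) (nev_homog t1)) !bichar0l // !scale1r !mulr1.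
  by rewrite tensBl tensZl.
have BB : br al be (tn 1 x) (tn 1 y) = tn 1 (br al be x y).
  rewrite /sbracket (tHH_mul _ _ (nev_homog t1) (grading1 S)).
  rewrite (tHH_mul _ _ (nev_homog t2) (grading1 S)) !bichar0r // !scale1r !mulr1.
  by rewrite tensBr tensZr.
(* The coefficient of the skew commutator is exactly what undoes the twist of the multiplication on
   the tensor square. *)
have AB : br al be (tn x 1) (tn 1 y) = 0.
  rewrite /sbracket (tHH_mul _ _ (grading1 S) (grading1 S)).
  rewrite (tHH_mul _ _ (nev_homog t2) (nev_homog t1)) bichar0l // scale1r.
  rewrite !mulr1 !mul1r scalerA mulVf ?scale1r ?subrr //; exact: bichar_neq0.
have DE : Delta S (br al be x y)
    = br al be (Delta S x) (Delta S y).
  by rewrite linearB linearZ !rmorphM.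
rewrite -[x * y - _]/(br al be x y) DE word_weight_cat.
have -> : br al be (Delta S x) (Delta S y)
      - (tn (br al be x y) 1 + tn 1 (br al be x y))
    = br al be r1 (Delta S y) + (br al be (tn x 1) r2
      + (br al be (tn 1 x) r2 + br al be (tn 1 x) (tn y 1))).
  rewrite {1}Ex sbracketDl -addrA; congr (_ + _).
  rewrite {1}Ey sbracketDl !sbracketDr AA BB AB addr0.
  move: (br al be (tn x 1) r2) (br al be (tn 1 x) r2) (br al be (tn 1 x) (tn y 1)).
  move: (tn (br al be x y) 1) (tn 1 (br al be x y)) => B1 B2 A1 A2 A3.
  by rewrite opprD !addrA [LHS](ACl (1*3*4*(2*6)*(5*7)))/= !subrr !addr0.
apply: lincombD; first exact: (tspan_br Hr1 Hy).
apply: lincombD; last first.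
  by apply: lincombD; [apply: (tspan_br HB1 Hr2b) | apply: (tspan_br HB1 HA2)].
(* The delicate term is [x (x) 1, r2]. A letter s of a left factor in r2 is below t2 < t1, so [t1 s]
   expands in letters at most t1 s < t1 t2. The new left factor is nonempty because its weight
   contains that of t1. *)
apply: lincomb_linear Hr2 => [|[W X] [/= W0 Wb WX]]; first exact: sbracket_linear.
rewrite br_tensl_ev2 //.
have HX : linear (fun z => tn z (ev X)) by apply: tens_linearl.
have : lincomb (sw_span g d b (al + sww W)) ev (br al (sww W) x (ev W)).
  apply: span_br => // [|s sW].
    by apply: sub_all Wb => s /wlt_trans; apply.
  have lts := allP Wb s sW.
  have := span_bracket lambda_bichar a g d st1 (valP s) (wlt_trans lts lt21).
  by apply: span_mono => s' /wle_wlt_trans; apply; rewrite wlt_cat2l.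
apply: (lincomb_linear HX) => Y [Yw Yb].
apply: (lincomb_gen ev2 (i := (Y, X))); split=> //=; last first.
  by rewrite Yw -addrA WX.
case: Y {Yb} Yw => // /(congr1 fst); rewrite sw_weight_nil /= => /esym/eqP.
rewrite addn_eq0 => /andP[/eqP al0 _].
by have := wdeg_gt0 d_gt0 (erase_neq0 t1); rewrite al0.
Qed.

Lemma DeltaM x y : Delta S (x * y) = Delta S x * Delta S y.
Proof. by rewrite rmorphM. Qed.

Local Notation lspan u := (tspan (fun s => sl_lt s u) (fun s => sl_le s u)).

Lemma Delta_superletter u t : sl_le t u ->
  lincomb (lspan u true (ww (sl_word t)))
    ev2 (Delta S (sl_eval lambda g a t)
         - (tn (sl_eval lambda g a t) 1 + tn 1 (sl_eval lambda g a t))).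
Proof.
move=> tu; apply: lincomb_mono (Delta_nev (valP t)) => -[[|s W] X] [/= _ //].
move=> /andP[st Wb] WX.
have lt s' : wlt (sl_word s') (erase (val t)) -> sl_lt s' u.
  by move=> /wlt_wle_trans; apply.
split; rewrite //= ?lt ?sl_ltW ?lt //.
by apply: sub_all Wb => s' /lt/sl_ltW.
Qed.

Lemma Delta_below u V : all (fun t => sl_lt t u) V ->
  lincomb (lspan u true (sww V)) ev2
    (Delta S (ev V) - tn 1 (ev V)).
Proof.
elim: V => [_|t V IH] /=.
  by rewrite ev_nil rmorph1 tens11 subrr; apply: lincomb0.
case/andP=> tu Vu; rewrite ev_cons sw_weight_cons DeltaM.
have {}IH := IH Vu; set x := sl_eval _ _ _ t; set r := Delta S (ev V) - _ in IH.
pose r' := Delta S x - tn 1 x.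
have Hr' : lincomb (lspan u true (ww (sl_word t)))
    ev2 r'.
  have -> : r' = (Delta S x - (tn x 1 + tn 1 x)) + tn x 1.
    by rewrite /r' opprD addrA addrAC subrK.
  apply: lincombD; first exact/Delta_superletter/sl_ltW.
  have -> : tn x 1 = ev2 ([:: t], [::]) by rewrite /ev2 /= ev_seq1 ev_nil.
  apply: lincomb_gen; split; rewrite /= ?tu ?sl_ltW //.
  by rewrite sw_weight_seq1 sw_weight_nil addr0.
have -> : Delta S (ev V) = r + tn 1 (ev V) by rewrite subrK.
have -> : Delta S x = r' + tn 1 x by rewrite subrK.
have HV : lincomb (lspan u false (sww V)) ev2 (tn 1 (ev V)).
  have -> : tn 1 (ev V) = ev2 ([::], V) by rewrite /ev2 ev_nil.
  by apply: lincomb_gen; split; rewrite //= sw_weight_nil add0r.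
have Hx : lincomb (lspan u false (ww (sl_word t)))
  ev2 (tn 1 x) by apply: (tspan_tensr _ _ (valP t)).
have VV : tn 1 x * tn 1 (ev V) = tn 1 (x * ev V).
  by rewrite (tHH_mul _ _ (nev_homog _) (grading1 S)) bichar0r // scale1r mul1r.
clearbody r r'; rewrite mulrDl mulrDr [tn 1 x * _]mulrDr VV !addrA addrK.
apply: lincombD; last exact: (tspanM Hx IH).
by apply: lincombD; [apply: (tspanM Hr' IH) | apply: (tspanM Hr' HV)].
Qed.

(** Serves for the lower-degree terms of a relation, where only the total degree of the two factors
    matters. *)
Lemma Delta_ev W : lincomb (tspan predT predT false (sww W)) ev2 (Delta S (ev W)).
Proof.
elim: W => [|t W IH].
  have -> : Delta S (ev [::]) = ev2 ([::], [::]).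
    by rewrite /ev2 /= ev_nil tens11 rmorph1.
  by apply: lincomb_gen; split; rewrite //= sw_weight_nil addr0.
rewrite ev_cons DeltaM sw_weight_cons; apply: (tspanM (nz := false) _ IH).
set x := sl_eval _ _ _ t; rewrite -[Delta S x](subrK (tn x 1 + tn 1 x)).
apply: lincombD; first by apply: tspan_mono (Delta_nev (valP t)).
apply: lincombD; last exact: (tspan_tensr _ _ (valP t)).
by apply: (tspan_mono (h := predT) (b := predT) (nz := true)) => //;
  apply: (tspan_tensl (st := valP t)).
Qed.

(* The remainder spans tensors whose left factor involves a superletter below
   [u], whereas the left factors of the main part are powers of [u]. *)
Lemma Delta_power u V m : all (fun t => sl_lt t u) V ->
  lincomb (lspan u true (sww (V ++ nseq m u))) ev2
    (Delta S (ev (V ++ nseq m u))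
     - \sum_(k < m.+1)
         (qbin (lambda (ww (sl_word u)).2 (ww (sl_word u)).2) m k
            * lambda (sww V).2 (ww (sl_word u)).2 ^+ k)
         *: ev2 (nseq k u, V ++ nseq (m - k) u)).
Proof.
move=> Vu; set q := lambda _.2 _.2; set l := lambda _.2 _.2.
elim: m => [|m IH].
  by rewrite big_ord1 /= cats0 mulr1 scale1r /ev2 /= ev_nil; apply: Delta_below.
have wVu j : lambda (sww (V ++ nseq j u)).2 (ww (sl_word u)).2 = l * q ^+ j.
  elim: j => [|j IHj]; first by rewrite cats0 mulr1.
  rewrite /= sw_weight_cat sw_weight_cons addrCA -sw_weight_cat /= bicharDl //.
  by rewrite IHj exprS mulrCA.
set c := fun m k => qbin q m k * l ^+ k.
set E := fun m k => ev2 (nseq k u, V ++ nseq (m - k) u).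
set x := sl_eval lambda g a u.
have EA k : (k <= m)%N -> E m k * tn x 1 = (l * q ^+ (m - k)) *: E m.+1 k.+1.
  have -> : tn x 1 = ev2 ([:: u], [::]) by rewrite /ev2 /= ev_seq1 ev_nil.
  move=> km; rewrite ev2M sw_weight_seq1 wVu cats0; congr (_ *: ev2 (_, _)).
  by rewrite -[[:: u]]/(nseq 1 u) -nseqD addn1.
have EB k : (k <= m)%N -> E m k * tn 1 x = E m.+1 k.
  have -> : tn 1 x = ev2 ([::], [:: u]) by rewrite /ev2 /= ev_seq1 ev_nil.
  move=> km; rewrite ev2M sw_weight_nil bichar0r // scale1r cats0 -catA.
  by rewrite -[[:: u]]/(nseq 1 u) -nseqD addn1 /E subSn.
(* Pascal's rule: [tn x 1] raises the exponent on the left at the cost [l * q ^+ (m - k)], and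
   [tn 1 x] raises it on the right at no cost. *)
have Hm : \sum_(k < m.+2) c m.+1 k *: E m.+1 k
        = (\sum_(k < m.+1) c m k *: E m k) * (tn x 1 + tn 1 x).
  rewrite mulr_suml big_ord_recl.
  under [RHS]eq_bigr => k _.
    rewrite -scalerAl mulrDr EA -1?ltnS // EB -1?ltnS // scalerDr scalerA.
    over.
  rewrite big_split /= [RHS]addrC.
  rewrite [X in _ = X + _](_ : _ = \sum_(k < m.+2) c m k *: E m.+1 k); last first.
    by rewrite [RHS]big_ord_recr /= /c qbin_small // mul0r scale0r addr0.
  rewrite [X in _ = X + _]big_ord_recl -addrA.
  congr (_ + _); first by rewrite /c /=; case: (m).
  rewrite -big_split /=; apply: eq_bigr => k _; rewrite -scalerDl; congr (_ *: _).
  rewrite /c /= mulrDl exprS; congr (_ + _).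
  rewrite -!mulrA mulrC -!mulrA; congr (_ * _).
  by rewrite mulrCA mulrC -mulrA.
have -> : V ++ nseq m.+1 u = (V ++ nseq m u) ++ [:: u] by rewrite -addn1 nseqD catA.
rewrite Hm ev_cat ev_seq1 DeltaM sw_weight_cat sw_weight_seq1 -/x.
have Hu := Delta_superletter (sl_lexx u); rewrite -/x in Hu.
set M := \sum_(k < m.+1) c m k *: E m k; set D := Delta S (ev _).
have {}IH : lincomb (lspan u true (sww (V ++ nseq m u))) ev2 (D - M) := IH.
set r := D - M in IH; set r1 := Delta S x - _ in Hu.
have -> : D * Delta S x - M * (tn x 1 + tn 1 x) = r * Delta S x + M * r1.
  by rewrite mulrBl mulrBr addrA subrK.
have HA : lincomb (lspan u false (ww (sl_word u))) ev2 (tn x 1).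
  have -> : tn x 1 = ev2 ([:: u], [::]) by rewrite /ev2 /= ev_seq1 ev_nil.
  apply: lincomb_gen; split; rewrite /= ?sl_lexx //.
  by rewrite sw_weight_seq1 sw_weight_nil addr0.
have HB : lincomb (lspan u false (ww (sl_word u))) ev2 (tn 1 x).
  exact: (tspan_tensr _ _ (valP u)).
have HM : lincomb (lspan u false (sww (V ++ nseq m u))) ev2 M.
  apply: lincomb_sum => k _; apply/lincombZ/lincomb_gen; split=> //=.
    by rewrite all_nseq sl_lexx orbT.
  rewrite !sw_weight_cat addrCA; congr (_ + _).
  by rewrite -sw_weight_cat -nseqD subnKC // -ltnS.
apply: lincombD; last exact: (tspanM HM Hu).
apply: (tspanM (nz := true) (nz' := false) IH).
have -> : Delta S x = r1 + (tn x 1 + tn 1 x) by rewrite subrK.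
by apply: lincombD; [apply: tspan_mono Hu | apply: lincombD].
Qed.

End Coproduct.

(** * Spanning *)

Section SuperwordOrder.
Variable n : nat.
Implicit Types (s t : superletter n) (W X Y : superword n).

(* A superword and its proper beginnings are left incomparable: only superwords
   of the same degree get compared. *)
Fixpoint sw_lt W X : bool :=
  match W, X with
  | s :: W', t :: X' => sl_lt s t || ((s == t) && sw_lt W' X')
  | _, _ => false
  end.

Definition sw_le W X := (W == X) || sw_lt W X.

Lemma sw_lt_trans : transitive sw_lt.
Proof.
move=> X W Y; elim: X W Y => [|t X IH] [|s W] [|u Y] //=.
case/orP=> [st|/andP[/eqP-> WX]]; case/orP=> [tu|/andP[/eqP<- XY]].
- by rewrite (sl_lt_trans st tu).
- by rewrite st.
- by rewrite tu.
- by rewrite eqxx (IH _ _ WX XY) orbT.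
Qed.

Lemma sw_ltxx W : sw_lt W W = false.
Proof. by elim: W => //= t W ->; rewrite sl_ltxx andbF. Qed.

Lemma sw_le_lt_trans X W Y : sw_le W X -> sw_lt X Y -> sw_lt W Y.
Proof. by case/orP=> [/eqP-> //|]; apply: sw_lt_trans. Qed.

Lemma sw_lt_cat2l A W X : sw_lt W X -> sw_lt (A ++ W) (A ++ X).
Proof. by move=> WX; elim: A => //= t A ->; rewrite eqxx orbT. Qed.

Definition sw_words W : seqlexi (seqlexi 'I_n) := map (@sl_word n) W.

Lemma sw_words_lt W X : sw_lt W X -> (sw_words X < sw_words W)%O.
Proof.
elim: W X => [|s W IH] [|t X] //= /orP[st|/andP[/eqP-> /IH WX]].
  have lt_ts : ((sl_word t : seqlexi 'I_n) < (sl_word s : seqlexi 'I_n))%O := st.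
  by rewrite ltxi_cons (ltW lt_ts) leNgt lt_ts.
by rewrite ltxi_cons lexx.
Qed.

(** Lexicographic descent need not stop in general. In degree m the number of letters and their
    lengths are at most m, so only finitely many candidates lie below a word, and the rank counts
    them; the inequality is reversed as in [wlt]. *)
Definition sw_rank m W :=
  #|[pred x : m.-bseq (m.-bseq 'I_n) |
      (sw_words W < (map val x : seqlexi (seqlexi 'I_n)))%O]|.

Lemma sw_rank_lt m W X : sw_lt W X -> (size W <= m)%N ->
  all (fun t => size (sl_word t) <= m)%N W -> (sw_rank m W < sw_rank m X)%N.
Proof.
move=> /sw_words_lt ltXW sW sWm; apply/proper_card/fintype.properP; split.
  by apply/fintype.subsetP=> x; rewrite !inE; apply: lt_trans.
pose x : m.-bseq (m.-bseq 'I_n) :=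
  insub_bseq m [seq insub_bseq m (sl_word t) | t <- W].
have xE : map val x = sw_words W.
  rewrite /x {1}/insub_bseq insubdK ?unfold_in ?size_map //.
  elim: W sWm {sW ltXW x} => //= t W IH /andP[st sW].
  by rewrite IH // /insub_bseq insubdK.
by exists x; rewrite !inE xE // ltxx.
Qed.

Lemma unsorted_split (T : Type) (r : rel T) (s : seq T) : ~~ sorted r s ->
  exists A x y B, s = A ++ x :: y :: B /\ ~~ r x y.
Proof.
case: s => // x s; elim: s x => //= y s IH x; rewrite negb_and.
case/orP=> [nxy|/IH[A [z [w [B [-> nzw]]]]]]; first by exists [::], x, y, s.
by exists (x :: A), z, w, B.
Qed.

Lemma sorted_block t W : sorted (@sl_le n) W ->
  W = [seq s <- W | sl_lt s t] ++ nseq (count_mem t W) t ++ [seq s <- W | sl_lt t s].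
Proof.
elim: W => //= s W IH path_sW; have sW := path_sorted path_sW.
have le_s := order_path_min (@sl_le_trans n) path_sW.
have lt_t x : x \in W -> sl_le t s -> sl_lt x t = false.
  move=> /(allP le_s) sx ts; apply/negbTE.
  by rewrite sl_ltNge negbK; apply: sl_le_trans sx.
have none : sl_le t s -> [seq x <- W | sl_lt x t] = [::].
  by move=> ts; rewrite (eq_in_filter (a2 := pred0)) ?filter_pred0 // => x /lt_t->.
have [st|] := boolP (sl_lt s t).
  have -> : (s == t) = false by apply: contraTF st => /eqP->; rewrite sl_ltxx.
  have -> : sl_lt t s = false.
    by apply/negbTE; rewrite sl_ltNge negbK sl_ltW.
  by rewrite /= {1}(IH sW).
rewrite sl_ltNge negbK => ts; have [->|nst] := eqVneq s t.
  by rewrite sl_ltxx /= {1}(IH sW) none.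
have -> : sl_lt t s by rewrite sl_lt_neqAle eq_sym nst.
rewrite none //= (count_memPn _) /=.
  rewrite (eq_in_filter (a2 := predT)) ?filter_predT // => x xW.
  rewrite sl_lt_neqAle (sl_le_trans ts (allP le_s _ xW)) andbT.
  apply: contraNneq nst => tx; apply/eqP/sl_le_anti.
  by rewrite ts tx (allP le_s).
apply/negP=> /(allP le_s) st; case/eqP: nst; apply: sl_le_anti.
by rewrite st.
Qed.

Lemma sorted_max_block t W : sorted (@sl_le n) W -> all (fun s => sl_le s t) W ->
  W = [seq s <- W | sl_lt s t] ++ nseq (count_mem t W) t.
Proof.
move=> srt leW; rewrite {1}(sorted_block t srt).
rewrite [X in _ ++ (_ ++ X)](_ : _ = [::]) ?cats0 //.
apply/eqP; rewrite -[_ == _]negbK -has_filter -all_predC.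
by apply: sub_all leW => s /=; rewrite sl_ltNge negbK.
Qed.

End SuperwordOrder.

Section Spanning.
Variables (K : fieldType) (G : zmodType) (lambda : G -> G -> K).
Hypothesis lambda_bichar : bicharacter lambda.
Variables (H : algType K) (n : nat) (a : 'I_n -> H) (g : 'I_n -> G).
Variable d : 'I_n -> nat.
Hypothesis d_gt0 : forall i, (0 < d i)%N.
Local Notation ev := (sw_eval lambda g a).
Local Notation deg := (sw_deg d).
Implicit Types (s t : superletter n) (W X Y A B : superword n).

(** The restricted monotonic words in hard super-letters as plain super-words, with multiplicities
    in place of exponents; this form suits rewriting. *)
Definition pbw_word W : Prop := sorted (@sl_le n) W /\
  forall t, t \in W ->
    hard lambda g a d t /\ lt_height lambda g a d t (count_mem t W).

Definition sw_smaller W X : Prop := (deg X = deg W /\ sw_lt X W) \/ (deg X < deg W)%N.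

Lemma deg_nseq h t : deg (nseq h t) = (h * wdeg d (sl_word t))%N.
Proof. by rewrite /sw_deg big_nseq iter_addn_0 mulnC. Qed.

Lemma ev_nseq h t : ev (nseq h t) = sl_eval lambda g a t ^+ h.
Proof. by elim: h => [|h IH]; rewrite ?ev_nil // exprS -IH -ev_cons. Qed.

Lemma size_le_wdeg (u : seq 'I_n) : (size u <= wdeg d u)%N.
Proof.
elim: u => //= i u IH; rewrite /wdeg big_cons -add1n.
by apply: leq_add => //; apply: d_gt0.
Qed.

Lemma size_le_deg W : (size W <= deg W)%N.
Proof.
elim: W => //= t W IH; rewrite /sw_deg big_cons -add1n.
by apply: leq_add => //; apply/wdeg_gt0/sl_word_neq0.
Qed.

(** The comparison is required at the first letter of the replaced block: there it holds whatever
    follows, even when the replacement has another length. *)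
Lemma smaller_context A X Y B x :
  lincomb (fun Z => (deg Z = deg Y /\ exists s t Z' Y',
     [/\ Z = s :: Z', Y = t :: Y' & sl_lt s t]) \/ (deg Z < deg Y)%N) ev x ->
  lincomb (sw_smaller (A ++ Y ++ B)) ev (ev A * (x * ev B)).
Proof.
move=> Hx.
have lin : linear (fun z => ev A * (z * ev B)).
  by move=> c y z; rewrite mulrDl mulrDr -scalerAl -scalerAr.
move: x Hx; apply: (lincomb_linear lin) => Z HZ; rewrite -!ev_cat.
apply: lincomb_gen; rewrite /sw_smaller !sw_deg_cat.
case: HZ => [[-> [s [t [Z' [Y' [-> -> st]]]]]]|lt]; [left|right].
  by split=> //; apply: sw_lt_cat2l; rewrite /= st.
by rewrite ltn_add2l ltn_add2r.
Qed.

Lemma lincomb_smaller W : ~ pbw_word W -> lincomb (sw_smaller W) ev (ev W).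
Proof.
move=> nW; have [sW|/unsorted_split] := boolP (sorted (@sl_le n) W); last first.
  case=> [A [v [w [B [-> nvw]]]]]; rewrite -sl_ltNge in nvw.
  rewrite -[v :: w :: B]/([:: v; w] ++ B) !ev_cat.
  apply: smaller_context => //.
  (* Both parts begin with a letter below [v]: the bracket expands in letters at most vw < v, and
     the swapped word begins with w < v. *)
  have -> : ev [:: v; w] = sbracket lambda (word_weight g d (sl_word v))
      (word_weight g d (sl_word w)) (sl_eval lambda g a v) (sl_eval lambda g a w)
    + skewp lambda (word_weight g d (sl_word v)) (word_weight g d (sl_word w))
      *: ev [:: w; v].
    by rewrite !ev_cons !ev_nil !mulr1 subrK.
  apply: lincombD.
    apply: lincomb_mono (span_bracket lambda_bichar a g d (valP v) (valP w) nvw).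
    move=> Z [wZ bZ]; left.
    have degZ : deg Z = deg [:: v; w].
      by rewrite -!(sw_weight_deg g) wZ !sw_weight_cons sw_weight_nil addr0.
    split=> //; case: Z degZ bZ {wZ} => [|s Z] degZ /=; last first.
      case/andP=> bs _; exists s, v, Z, [:: w]; split=> //.
      by apply: wle_wlt_trans bs _; rewrite wlt_prefix sl_word_neq0.
    have := sw_deg_gt0 d_gt0 [:: v; w].
    by rewrite -degZ /sw_deg big_nil.
  apply/lincombZ/lincomb_gen; left; split; last by exists w, v, [:: v], [:: w].
  by rewrite /sw_deg !big_cons !big_nil !addn0 addnC.
(* One relation covers both failures: a letter that is not hard is the case h = 1, and otherwise h
   is the height. *)
have [t [h [c [h0 hc tW Hlow]]]] : exists t h c,
    [/\ (0 < h)%N, (h <= c)%N, c = count_mem t W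
    & lincomb (sw_lower d t (h * wdeg d (sl_word t))) ev (sl_eval lambda g a t ^+ h)].
  apply: contrapT => nex; apply: nW; split=> // t tW.
  have c0 : (0 < count_mem t W)%N by rewrite -has_count has_pred1.
  split=> [lowt|h [hc _]].
    by apply: nex; exists t, 1%N, (count_mem t W); rewrite mul1n expr1.
  rewrite ltnNge; apply/negP=> hcW; apply: nex; exists t, h, (count_mem t W).
  case: hc => -[m /prim_order_gt0 m0 hE] low; split=> //.
  case: hE => [->//|[l [k [lK ->]]]].
  by rewrite muln_gt0 m0 expn_gt0 prime_gt0 // (pcharf_prime lK).
rewrite (sorted_block t sW) -tW -(subnKC hc) nseqD -!catA.
set A := [seq s <- W | sl_lt s t]; set B := nseq _ _ ++ _.
rewrite ev_cat ev_cat; apply: smaller_context => //.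
rewrite ev_nseq; apply: lincomb_mono Hlow => Z [[degZ ltZ]|ltZ]; last first.
  by right; rewrite deg_nseq.
left; rewrite deg_nseq; split=> //.
case: Z degZ ltZ => [|s Z] degZ /= => [_|/andP[st _]].
  have := wdeg_gt0 d_gt0 (sl_word_neq0 t); move/esym/eqP: degZ.
  by rewrite /sw_deg big_nil muln_eq0 gtn_eqF //= => /eqP->.
by case: h h0 {hc B degZ} => // h _; exists s, t, Z, (nseq h t).
Qed.

(** Induction on the degree and, within a degree, on the rank. The bound by [W] is recorded because
    the functional for [[u]^k] depends on it. *)
Lemma pbw_span W : lincomb (fun X => pbw_word X /\
  ((deg X = deg W /\ sw_le X W) \/ (deg X < deg W)%N)) ev (ev W).
Proof.
have [m] := ubnP (deg W); elim: m W => // m IHm W; rewrite ltnS => degW.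
have [r] := ubnP (sw_rank (deg W) W); elim: r W degW => // r IHr W degW.
rewrite ltnS => rankW; have [hW|nhW] := pselect (pbw_word W).
  by apply: lincomb_gen; split=> //; left; rewrite /sw_le eqxx.
apply: lincomb_trans (lincomb_smaller nhW) => X [[degX ltX]|ltX]; last first.
  apply: lincomb_mono (IHm X (leq_trans ltX degW)) => Y [hY HY]; split=> //.
  by right; case: HY => [[-> _]//|/ltn_trans]; apply.
have rX : (sw_rank (deg X) X < r)%N.
  apply: leq_trans rankW; rewrite degX; apply: sw_rank_lt => //.
    by rewrite -degX size_le_deg.
  apply/allP=> t tX; apply: leq_trans (size_le_wdeg _) _.
  by rewrite -degX; apply: sw_deg_mem.
apply: lincomb_mono (IHr X _ rX) => [Y [hY HY]|]; last by rewrite degX.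
split=> //; case: HY => [[degY leY]|ltY]; last by right; rewrite -degX.
by left; rewrite degY; split=> //; rewrite /sw_le (sw_le_lt_trans leY ltX) orbT.
Qed.

End Spanning.

(** * Linear independence *)

Lemma lincomb_uniq (K : fieldType) (V : lmodType K) (I : eqType)
    (D : I -> Prop) (e : I -> V) x : lincomb D e x ->
  exists (s : seq I) (c : I -> K), [/\ uniq s, forall i, i \in s -> D i
    & x = \sum_(i <- s) c i *: e i].
Proof.
case=> m [w [c [Dw ->]]].
exists (undup (codom w)), (fun i => \sum_(j | w j == i) c j).
split; first exact: undup_uniq.
  by move=> i; rewrite mem_undup => /codomP[j ->].
transitivity (\sum_j \sum_(i <- undup (codom w) | w j == i) c j *: e i).
  apply: eq_bigr => j _; rewrite -big_filter.
  have -> : [seq i <- undup (codom w) | w j == i] = [:: w j].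
    rewrite (eq_filter (a2 := pred1 (w j))); last by move=> i /=; rewrite eq_sym.
    by apply: filter_pred1_uniq; rewrite ?undup_uniq // mem_undup codom_f.
  by rewrite big_seq1.
rewrite (exchange_big_dep xpredT) //=; apply: eq_bigr => i _.
by rewrite scaler_suml; apply: eq_bigl.
Qed.

Lemma exists_max n (s : seq (superletter n)) : s != [::] ->
  exists2 u, u \in s & all (fun t => sl_le t u) s.
Proof.
elim: s => // t s IH _; have [->|/IH[u us leu]] := eqVneq s [::].
  by exists t; rewrite ?mem_head //= sl_lexx.
have [tu|] := boolP (sl_le t u).
  by exists u; rewrite /= ?tu // inE us orbT.
rewrite -sl_ltNge => ut; exists t; rewrite ?mem_head //= sl_lexx.
by apply: sub_all leu => x xu; apply: sl_le_trans xu (sl_ltW ut).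
Qed.

Section Independence.
Variables (K : fieldType) (G : zmodType) (lambda : G -> G -> K).
Hypothesis lambda_bichar : bicharacter lambda.
Variables (H : algType K) (S : graded_hopf lambda H).
Variables (n : nat) (a : 'I_n -> H) (g : 'I_n -> G) (d : 'I_n -> nat).
Hypothesis d_gt0 : forall i, (0 < d i)%N.
Hypothesis a_homog : forall i, a i \in grading S (g i).
Hypothesis a_prim : forall i, primitive_elt S (a i).
Local Notation ev := (sw_eval lambda g a).
Local Notation ww := (word_weight g d).
Local Notation sww := (sw_weight g d).
Local Notation deg := (sw_deg d).
Local Notation pbw_word := (pbw_word lambda a g d).
Implicit Types (t u : superletter n) (W X Y V : superword n) (s : seq (superword n)).

Definition below m := lincomb (fun X => (deg X < m)%N) ev.

(** A relation is allowed an error of lower degree, so that it survives both reduction and the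
    coproduct. Nonzero coefficients make triviality the emptiness of the list. *)
Definition leading_indep m : Prop :=
  forall s (c : superword n -> K), uniq s ->
    (forall X, X \in s -> [/\ pbw_word X, deg X = m & c X != 0]) ->
    below m (\sum_(X <- s) c X *: ev X) -> s = [::].

(** The coproduct strips powers of [u] from basis words; multiplicities only drop, so the rest is
    again a basis word. *)
Lemma pbw_word_subseq W X : subseq W X -> pbw_word X -> pbw_word W.
Proof.
move=> sub [srt hX]; split; first exact: subseq_sorted (@sl_le_trans n) _ _ sub srt.
move=> t /(mem_subseq sub) /hX[ht ltht]; split=> // h /ltht.
by apply: leq_ltn_trans; apply: leq_count_subseq.
Qed.

Lemma sw_lt_nseq u k W : all (fun t => sl_le t u) W -> has (fun t => sl_lt t u) W ->
  deg W = deg (nseq k u) -> sw_lt W (nseq k u).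
Proof.
elim: W k => //= t W IH [|k] /andP[tu Wu] hW.
  by move=> degW; have := sw_deg_gt0 d_gt0 (t :: W); rewrite degW /sw_deg big_nil.
rewrite /= /sw_deg !big_cons => degW; move: tu; rewrite sl_leE.
case/orP=> [/eqP tu|->//]; rewrite tu eqxx; apply/orP; right; apply: IH => //.
  by move: hW; rewrite tu sl_ltxx.
by move: degW; rewrite tu => /addnI.
Qed.

Lemma power_functional u k : pbw_word (nseq k u) -> leading_indep (deg (nseq k u)) ->
  exists f : H -> K^o, [/\ linear f, f (ev (nseq k u)) = 1,
    (forall W, (deg W < deg (nseq k u))%N -> f (ev W) = 0)
    & (forall W, deg W = deg (nseq k u) -> all (fun t => sl_le t u) W ->
         has (fun t => sl_lt t u) W -> f (ev W) = 0)].
Proof.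
set i := deg _ => hu indep.
pose D Y := [/\ pbw_word Y, deg Y = i & Y <> nseq k u] \/ (deg Y < i)%N.
have nD : ~ lincomb D ev (ev (nseq k u)).
  (* Such a combination would be a top-degree relation in which [[u]^k] has coefficient 1; [s1]
     keeps the terms of degree [i] with nonzero coefficient. *)
  case/lincomb_uniq=> s [b [us Ds uE]].
  pose s1 := [seq Y <- s | (b Y != 0) && (deg Y == i)].
  pose c Y := if Y == nseq k u then 1 else - b Y.
  have s1u : nseq k u \notin s1.
    rewrite mem_filter; apply/negP=> /andP[/andP[_ /eqP degu] /Ds[[_ _ //]|]].
    by rewrite degu ltnn.
  suff: nseq k u :: s1 = [::] by [].
  apply: (indep _ c) => [|X|]; first by rewrite /= s1u filter_uniq.
    rewrite inE /c; case: eqP => [-> _|nX]; first by rewrite oner_neq0.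
    rewrite /= mem_filter oppr_eq0 => /andP[/andP[b0 /eqP degX] /Ds[[]//|]].
    by rewrite degX ltnn.
  rewrite big_cons /c eqxx scale1r big_seq.
  rewrite (eq_bigr (fun X => - (b X *: ev X))); last first.
    move=> X Xs1; rewrite ifN ?scaleNr //.
    by apply: contraNneq s1u => <-.
  rewrite -big_seq sumrN {1}uE (bigID (fun Y => (b Y != 0) && (deg Y == i))) /=.
  rewrite big_filter addrAC subrr add0r big_seq_cond; apply: lincomb_sum => Y.
  case/andP=> /Ds DY; rewrite negb_and negbK.
  case/orP=> [/eqP->|]; first by rewrite scale0r; apply: lincomb0.
  by case: DY => [[_ -> _]|ltY _]; rewrite ?eqxx //; apply/lincombZ/lincomb_gen.
have [f [lin_f f1 fD]] := separating_functional nD.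
exists f; split=> // [W ltW|W degW leW hW]; first by apply: fD; right.
have f0 : f 0 = 0.
  by have := lin_f (-1) 0 0; rewrite scaler0 add0r scaleN1r addNr.
have : lincomb D ev (ev W).
  apply: lincomb_mono (pbw_span lambda_bichar a g d_gt0 W) => Y [hY].
  case=> [[degY leY]|ltY]; last by right; rewrite -degW.
  left; split=> //; first by rewrite degY.
  move=> Yu; have := sw_le_lt_trans leY (sw_lt_nseq leW hW degW).
  by rewrite Yu sw_ltxx.
apply: (lincomb_ind (Q := fun x => f x = 0)) => // b x y fx fy.
by rewrite lin_f fx fy scaler0 addr0.
Qed.

(* Comparing the coefficients of [u]^k in the left tensor factor of [Delta]
   produces a relation in degree [m - deg [u]^k]. *)
Lemma leading_step m u s (c : superword n -> K) k X0 :
  (forall m', (m' < m)%N -> leading_indep m') -> uniq s ->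
  (forall X, X \in s -> [/\ pbw_word X, deg X = m & c X != 0]) ->
  below m (\sum_(X <- s) c X *: ev X) ->
  (forall X, X \in s -> all (fun t => sl_le t u) X) ->
  X0 \in s -> (0 < k <= count_mem u X0)%N -> (deg (nseq k u) < m)%N ->
  qbin (lambda (ww (sl_word u)).2 (ww (sl_word u)).2) (count_mem u X0) k = 0.
Proof.
move=> IHm us Hs Hsum leu X0s /andP[k0 kX0] ltm.
set q := lambda _ _; set i := deg (nseq k u) in ltm.
pose V X := [seq t <- X | sl_lt t u]; pose N X := count_mem u X.
have XE X : X \in s -> X = V X ++ nseq (N X) u.
  by move=> Xs; have [[srt _] _ _] := Hs X Xs; apply: sorted_max_block (leu X Xs).
have i0 : (0 < i)%N by rewrite /i (sw_deg_gt0 d_gt0); case: (k) k0.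
have hu : pbw_word (nseq k u).
  have [hX0 _ _] := Hs X0 X0s; apply: pbw_word_subseq hX0.
  by rewrite (XE X0 X0s) -(subnK (kX0 : (k <= N X0)%N)) nseqD catA suffix_subseq.
have [f [lin_f f1 flt feq]] := power_functional hu (IHm _ ltm).
have bil : bilinear_for *:%R *:%R (fun y z : H => (f y : K) *: z).
  split=> [z b x y|y b x z] /=.
    by rewrite lin_f scalerDl scalerA.
  by rewrite scalerDr !scalerA mulrC.
(* [phi] is f (x) id followed by the identification of K (x) H with H. *)
pose phi := tens_lift (tHH S) (fun y z : H => (f y : K) *: z).
have lin_phi : linear phi := tens_lift_linear (tHH S) bil.
have phiE W X : phi (ev2 S a g (W, X)) = (f (ev W) : K) *: ev X.
  exact: tens_liftE bil _ _.
clearbody phi.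
have phiD x y : phi (x + y) = phi x + phi y.
  by have := lin_phi 1 x y; rewrite !scale1r.
have phi0 : phi 0 = 0 by apply: (addIr (phi 0)); rewrite -phiD !add0r.
have phiZ b x : phi (b *: x) = b *: phi x.
  by have := lin_phi b x 0; rewrite phi0 !addr0.
(* Below degree i the left factor is killed by [f]; above i the right factor has degree less than m
   - i. At i either the total degree is less than m or [f] vanishes by assumption. *)
have phi_low W X : (deg W + deg X <= m)%N ->
    (deg W + deg X < m)%N \/ (deg W = i -> f (ev W) = 0) ->
    below (m - i) (phi (ev2 S a g (W, X))).
  rewrite phiE => leWX HW; have [ltW|ltW|eqW] := ltngtP (deg W) i.
  - by rewrite flt // scale0r; apply: lincomb0.
  - by apply/lincombZ/lincomb_gen; lia.
  - case: HW => [ltWX|->//]; first by apply/lincombZ/lincomb_gen; lia.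
    by rewrite scale0r; apply: lincomb0.
have lin_phiD : linear (fun x => phi (Delta S x)).
  by move=> b x y; rewrite linearP lin_phi.
have Hphi : below (m - i) (phi (Delta S (\sum_(X <- s) c X *: ev X))).
  move: Hsum; apply: (lincomb_linear lin_phiD) => R ltR.
  apply: lincomb_linear lin_phi _ _ (Delta_ev lambda_bichar d_gt0 a_homog a_prim R).
  move=> [W X] [_ _ /(sww_add_deg)/=]; rewrite (sw_weight_deg g d R) => degWX.
  by apply: phi_low; rewrite degWX ?(ltnW ltR) //; left.
pose rm X := V X ++ nseq (N X - k) u.
pose coef X := qbin q (N X) k * lambda (sww (V X)).2 (ww (sl_word u)).2 ^+ k.
have main X : X \in s -> below (m - i) (phi (Delta S (ev X)) - coef X *: ev (rm X)).
  move=> Xs; have [_ degX _] := Hs X Xs.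
  have VX : all (fun t => sl_lt t u) (V X) by apply: filter_all.
  have := Delta_power lambda_bichar d_gt0 a_homog a_prim (N X) VX.
  rewrite -(XE X Xs) -/q; set M := \sum_(j < _) _ => HM.
  rewrite -[Delta S (ev X)](subrK M) phiD -addrA; apply: lincombD.
    apply: lincomb_linear lin_phi _ _ HM => -[W Y] [hW leW /sww_add_deg].
    rewrite (sw_weight_deg g d X) degX /= => degWY.
    by apply: phi_low; rewrite degWY //; right=> degW; apply: feq.
  rewrite (big_morph phi phiD phi0) (bigID (fun j : 'I_(N X).+1 => j == k :> nat)) /=.
  rewrite addrAC; apply: lincombD; last first.
    (* For j other than k the degree of [[u]^j] is not i, so the value of [f] in degree i is never
       asked for. *)
    apply: lincomb_sum => j /eqP jk; rewrite phiZ; apply/lincombZ/phi_low.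
      have -> : m = deg (V X ++ nseq (N X) u) by rewrite -XE.
      by rewrite !sw_deg_cat addnCA -(sw_deg_cat d (nseq j u)) -nseqD subnKC // -ltnS.
    right=> degj; case: jk; move/eqP: degj; rewrite /i !deg_nseq.
    by rewrite eqn_pmul2r ?wdeg_gt0 ?sl_word_neq0 // => /eqP.
  have [kN|Nk] := leqP k (N X).
    rewrite (big_pred1 (Ordinal (kN : (k < (N X).+1)%N))) /=; last by move=> j.
    by rewrite phiZ phiE f1 scale1r subrr; apply: lincomb0.
  rewrite big_pred0 => [|j].
    by rewrite /coef qbin_small // mul0r scale0r subrr; apply: lincomb0.
  by apply: contraTF Nk => /eqP <-; rewrite -leqNgt -ltnS.
apply: contrapT => /eqP qX0.
pose s' := [seq rm X | X <- s & coef X != 0].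
(* A nonzero coefficient forces k to be at most [N X], so the subtraction is not truncated and [X]
   is recovered by appending [[u]^k]; hence [rm] is injective on these words. *)
have rmK X : X \in s -> coef X != 0 -> rm X ++ nseq k u = X.
  move=> Xs; rewrite mulf_eq0 negb_or => /andP[qX _].
  rewrite -catA -nseqD subnK -?XE //; rewrite leqNgt; apply: contra qX => Nk.
  by rewrite qbin_small.
pose c' Y := c (Y ++ nseq k u) * coef (Y ++ nseq k u).
have mi : (m - i < m)%N by lia.
suff s'0 : s' = [::].
  have : rm X0 \in s'.
    apply: map_f; rewrite mem_filter X0s andbT mulf_neq0 // expf_neq0 //.
    exact: bichar_neq0.
  by rewrite s'0.
apply: (IHm _ mi s' c').
  rewrite map_inj_in_uniq ?filter_uniq // => X Y.
  rewrite !mem_filter => /andP[cX Xs] /andP[cY Ys] rmXY.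
  by rewrite -(rmK X) // rmXY rmK.
  move=> Y /mapP[X]; rewrite mem_filter => /andP[cX Xs] ->.
  have [hX degX cX0] := Hs X Xs; rewrite /c' (rmK X Xs cX) mulf_neq0 //.
  split=> //; last by rewrite -degX -{2}(rmK X Xs cX) sw_deg_cat addnK.
  by apply: pbw_word_subseq hX; rewrite -{2}(rmK X Xs cX) prefix_subseq.
rewrite big_map big_filter.
have -> : \sum_(X <- s | coef X != 0) c' (rm X) *: ev (rm X)
    = phi (Delta S (\sum_(X <- s) c X *: ev X))
      - \sum_(X <- s) c X *: (phi (Delta S (ev X)) - coef X *: ev (rm X)).
  rewrite raddf_sum (big_morph phi phiD phi0) -sumrB big_mkcond /=.
  rewrite big_seq [RHS]big_seq; apply: eq_bigr => X Xs.
  rewrite linearZ phiZ -scalerBr opprB addrCA subrr addr0 scalerA.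
  by case: eqP => [->|/eqP cX]; rewrite ?mulr0 ?scale0r // /c' rmK.
apply: lincombB => //; rewrite big_seq; apply: lincomb_sum => X Xs.
exact/lincombZ/main.
Qed.

Lemma leading_indep_all m : leading_indep m.
Proof.
have [m'] := ubnP m; elim: m' m => // m' IH m; rewrite ltnS => lemm'.
have IHm k : (k < m)%N -> leading_indep k.
  by move=> ltk; apply: IH; apply: leq_trans ltk lemm'.
clear m' lemm' IH.
(* In degree 0 the only word is the empty one, with value 1, and [below 0] is the zero space; the
   claim reduces to 1 being nonzero in [H]. *)
move=> s c us Hs Hsum; have [m0|m0] := posnP m.
  case: s us Hs Hsum => // X s /= /andP[Xs us] Hs Hsum.
  have nilX Y : Y \in X :: s -> Y = [::].
    move=> /Hs[_]; rewrite m0 => degY _; apply/eqP; rewrite -[_ == _]negbK.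
    by rewrite -(sw_deg_gt0 d_gt0) degY.
  have s0 : s = [::].
    case: s Xs nilX {us Hs Hsum} => // Y s XYs nilX; move: XYs.
    by rewrite (nilX X) ?mem_head // (nilX Y) ?mem_head // !inE eqxx ?orbT.
  have [_ _ /eqP cX] := Hs X (mem_head _ _).
  move: Hsum; rewrite s0 big_seq1 (nilX X) ?mem_head // ev_nil m0.
  case=> r [w [b [Hw]]]; rewrite big1 => [|j _]; last by have := Hw j.
  by move=> /eqP; rewrite scaler_eq0 oner_eq0 orbF -(nilX X) ?mem_head // => /eqP.
have [->//|s0] := eqVneq s [::].
have L0 : flatten s != [::].
  case: s s0 Hs {us Hsum} => // X s _ /(_ X (mem_head _ _))[_ degX _].
  have := sw_deg_gt0 d_gt0 X; rewrite degX m0 /= => /esym.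
  by case: X {degX}.
have [u /flattenP[X0 X0s uX0] leu] := exists_max L0.
have {}leu X : X \in s -> all (fun t => sl_le t u) X.
  by move=> Xs; apply/allP => t tX; apply: (allP leu); apply/flattenP; exists X.
pose q := lambda (ww (sl_word u)).2 (ww (sl_word u)).2.
have step X k : X \in s -> (0 < k <= count_mem u X)%N -> (deg (nseq k u) < m)%N ->
    qbin q (count_mem u X) k = 0.
  by move=> Xs; apply: (leading_step IHm us Hs Hsum leu Xs).
have XE X : X \in s -> X = [seq t <- X | sl_lt t u] ++ nseq (count_mem u X) u.
  by move=> Xs; have [[srt _] _ _] := Hs X Xs; apply: sorted_max_block (leu X Xs).
have power X : X \in s -> u \in X -> X = nseq (count_mem u X) u.
  move=> Xs uX; have c0 : (0 < count_mem u X)%N by rewrite -has_count has_pred1.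
  have [V0|V0] := eqVneq [seq t <- X | sl_lt t u] [::].
    by rewrite {1}(XE X Xs) V0.
  (* At the full multiplicity the Gaussian binomial is 1. This k is admissible because a letter
     below [u] makes the degree of [[u]^k] less than m. *)
  suff /eqP : qbin q (count_mem u X) (count_mem u X) = 0.
    by rewrite qbinn oner_eq0.
  apply: step => //; first by rewrite c0 leqnn.
  have [_ <- _] := Hs X Xs; rewrite [X in (_ < deg X)%N](XE X Xs) sw_deg_cat.
  by rewrite -[X in (X < _)%N]add0n ltn_add2r sw_deg_gt0.
set N := count_mem u X0; have X0E : X0 = nseq N u := power X0 X0s uX0.
have N0 : (0 < N)%N by rewrite -has_count has_pred1.
have [[_ /(_ u uX0)[hard_u lth_u]] degX0 cX0] := Hs X0 X0s.
have degN : (N * wdeg d (sl_word u))%N = m by rewrite -degX0 X0E deg_nseq.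
(* Solve the relation for [X0]. Another word containing [u] would be a power of [u] of the same
   degree, that is [X0] itself, so all the others have letters below [u]. *)
have low : lincomb (sw_lower d u m) ev (ev X0).
  rewrite -[ev X0]scale1r -(mulVf cX0) -scalerA; apply: lincombZ.
  have -> : c X0 *: ev X0
      = \sum_(X <- s) c X *: ev X - \sum_(X <- s | X != X0) c X *: ev X.
    by rewrite (bigD1_seq X0) //= addrK.
  apply: lincombB; first by apply: lincomb_mono Hsum => X; right.
  rewrite big_seq_cond; apply: lincomb_sum => X /andP[Xs XX0].
  apply/lincombZ/lincomb_gen; left; have [_ degX _] := Hs X Xs; split=> //.
  apply/allP=> t tX; rewrite sl_lt_neqAle (allP (leu X Xs)) // andbT.
  apply: contraNneq XX0 => tu; rewrite tu in tX.
  have XN := power X Xs tX; move/eqP: degX; rewrite {1}XN deg_nseq -degN.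
  rewrite eqn_pmul2r ?wdeg_gt0 ?sl_word_neq0 // => /eqP NX.
  by rewrite XN NX -X0E.
rewrite X0E ev_nseq in low.
have [N1|N2] := leqP N 1.
  have NE : N = 1%N by apply/eqP; rewrite eqn_leq N1.
  by case: hard_u; move: low; rewrite -degN NE expr1 mul1n.
have [|t qt Nt] := qbin_vanish (q := q) N2.
  move=> k /andP[k0 kN]; apply: step => //; first by rewrite k0 ltnW.
  by rewrite deg_nseq -degN ltn_pmul2r ?wdeg_gt0 ?sl_word_neq0.
have Nh : height_cond lambda g a d u N.
  by split; [exists t => //; apply: prim_rootV | rewrite degN].
(* [lt_height] refers to the least exponent satisfying the condition; one exists because N satisfies
   it. *)
have exh : exists h, `[< height_cond lambda g a d u h >] by exists N; apply/asboolP.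
have [h /asboolP hh hmin] := ex_minnP exh.
have : (N < h)%N by apply: lth_u; split=> // h' /asboolP/hmin.
by rewrite ltnNge hmin //; apply/asboolP.
Qed.

End Independence.

(** * Run-length encoding of monotonic superwords *)

Section RunLength.
Variable n : nat.
Implicit Types (t : superletter n) (w : seq (superletter n * nat)) (W : superword n).

Lemma monotonic_cons t k w : monotonic ((t, k) :: w) <->
  [/\ (0 < k)%N, all (fun p => sl_lt t p.1) w & monotonic w].
Proof.
have tr : transitive (fun p q : superletter n * nat => sl_lt p.1 q.1).
  by move=> p q r; apply: sl_lt_trans.
rewrite /monotonic /=; split=> [[pw /andP[k0 w0]]|[k0 tw [sw w0]]].
  by split; [|exact: order_path_min tr pw|split=> //; apply: path_sorted pw].
by rewrite k0 path_min_sorted.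
Qed.

Lemma mem_mon_superword t w : t \in mon_superword w -> exists2 p, p \in w & t = p.1.
Proof.
by case/flattenP=> _ /mapP[p pw ->]; rewrite mem_nseq => /andP[_ /eqP->]; exists p.
Qed.

Lemma count_mon_superword t k w : monotonic ((t, k) :: w) ->
  count_mem t (mon_superword w) = 0%N.
Proof.
case/monotonic_cons=> _ tw _; apply/count_memPn/negP=> /mem_mon_superword[p pw tp].
by have := allP tw p pw; rewrite tp sl_ltxx.
Qed.

Lemma count_monotonic w p : monotonic w -> p \in w ->
  count_mem p.1 (mon_superword w) = p.2.
Proof.
elim: w => // -[t k] w IH mw; have [_ tw sw] := (monotonic_cons t k w).1 mw.
rewrite inE count_cat count_nseq => /orP[/eqP->|pw] /=.
  by rewrite eqxx mul1n (count_mon_superword mw) addn0.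
rewrite [X in (X + _)%N](_ : _ = 0%N) ?IH //.
by rewrite (_ : (t == p.1) = false) //; apply: contraTF (allP tw p pw) => /eqP->;
  rewrite sl_ltxx.
Qed.

Lemma mon_superword_inj w w' : monotonic w -> monotonic w' ->
  mon_superword w = mon_superword w' -> w = w'.
Proof.
elim: w w' => [|[t k] w IH] [|[t' k'] w'] mw mw' //.
- by have [] := (monotonic_cons t' k' w').1 mw'; case: k' {mw'}.
- by have [] := (monotonic_cons t k w).1 mw; case: k {mw}.
have [k0 _ sw] := (monotonic_cons t k w).1 mw.
have [k'0 _ sw'] := (monotonic_cons t' k' w').1 mw'.
have ct := count_mon_superword mw; have ct' := count_mon_superword mw'.
rewrite -[mon_superword _]/(nseq k t ++ mon_superword w).
rewrite -[mon_superword ((t', _) :: _)]/(nseq k' t' ++ mon_superword w') => E.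
have tt' : t = t' by case: k k' k0 k'0 E {mw mw'} => [|k] [|k'] // _ _ [].
rewrite -{t'}tt' in ct' E mw' *.
have := congr1 (count_mem t) E.
rewrite !count_cat !count_nseq /= eqxx !mul1n ct ct' !addn0 => kk'.
move: E; rewrite kk' => /(congr1 (drop k')).
by rewrite !drop_size_cat ?size_nseq // => /IH->.
Qed.

Lemma mon_superword_surj W : sorted (@sl_le n) W ->
  exists2 w, monotonic w & mon_superword w = W.
Proof.
have [m] := ubnP (size W); elim: m W => // m IH [|t W] szW srt; first by exists [::].
have tW := order_path_min (@sl_le_trans n) srt.
have E := sorted_block t srt; rewrite /= sl_ltxx eqxx in E.
rewrite (eq_in_filter (a2 := pred0)) ?filter_pred0 /= in E; last first.
  by move=> s /(allP tW) ts; apply/negbTE; rewrite sl_ltNge negbK.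
case: E; set W' := [seq s <- W | sl_lt t s] => E.
have [||w mw wE] := IH W'.
- by rewrite ltnS in szW; apply: leq_ltn_trans szW; rewrite size_filter count_size.
- by apply: sorted_filter (path_sorted srt); apply: sl_le_trans.
exists ((t, (count_mem t W).+1) :: w); last first.
  rewrite -[mon_superword _]/(nseq (count_mem t W).+1 t ++ mon_superword w).
  by rewrite wE /= -E.
apply/monotonic_cons; split=> //; apply/allP=> p pw.
have : p.1 \in W'.
  rewrite -wE; apply/flattenP; exists (nseq p.2 p.1); first by apply/mapP; exists p.
  by rewrite mem_nseq eqxx andbT; case: mw => _ /allP; apply.
by rewrite mem_filter => /andP[].
Qed.

End RunLength.

(** * Passage from leading terms of super-words to the indexed basis *)

Section Basis.
Variables (K : fieldType) (G : zmodType) (lambda : G -> G -> K).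
Hypothesis lambda_bichar : bicharacter lambda.
Variables (H : algType K) (S : graded_hopf lambda H).
Variables (n : nat) (a : 'I_n -> H) (g : 'I_n -> G) (d : 'I_n -> nat).
Hypothesis d_gt0 : forall i, (0 < d i)%N.
Hypothesis a_homog : forall i, a i \in grading S (g i).
Hypothesis a_prim : forall i, primitive_elt S (a i).
Local Notation ev := (sw_eval lambda g a).
Local Notation deg := (sw_deg d).
Local Notation pbw_word := (pbw_word lambda a g d).
Implicit Types (W X : superword n).

Lemma pbw_indep (s : seq (superword n)) (c : superword n -> K) : uniq s ->
  (forall X, X \in s -> pbw_word X) -> \sum_(X <- s) c X *: ev X = 0 ->
  forall X, X \in s -> c X = 0.
Proof.
move=> us hs s0 X Xs.
pose s1 := [seq X <- s | c X != 0].
have [//|cX] := eqVneq (c X) 0.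
have Xs1 : X \in s1 by rewrite mem_filter cX.
have sum1 : \sum_(X <- s1) c X *: ev X = 0.
  rewrite big_filter -[RHS]s0 [RHS](bigID (fun X => c X != 0)) /=.
  rewrite [X in _ + X]big1 ?addr0 // => Y; rewrite negbK => /eqP->.
  exact: scale0r.
(* The relation loses its top-degree part one degree at a time; at bound 0 no word is left. *)
suff bound m : all (fun Y => deg Y < m)%N s1 -> s1 = [::].
  have E : s1 = [::].
    apply: (bound (\max_(Y <- s1) deg Y).+1); apply/allP=> Y Ys1.
    by rewrite ltnS (big_rem Y) //= leq_maxl.
  by rewrite E in Xs1.
elim: m => [|m IH] ltm; first by case: (s1) ltm.
have E : [seq Y <- s1 | deg Y == m] = [::].
  apply: (leading_indep_all lambda_bichar d_gt0 a_homog a_prim (m := m) (c := c)).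
  - by rewrite !filter_uniq.
  - move=> Y; rewrite !mem_filter => /andP[/eqP degY /andP[cY Ys]].
    by split=> //; apply: hs.
  rewrite big_filter; move: sum1; rewrite (bigID (fun Y => deg Y == m)) /=.
  move=> /eqP; rewrite addr_eq0 => /eqP->; apply: lincombN.
  rewrite big_seq_cond; apply: lincomb_sum => Y /andP[/(allP ltm) leY nY].
  by apply/lincombZ/lincomb_gen; rewrite ltn_neqAle nY.
apply: IH; apply/allP=> Y Ys1; rewrite ltn_neqAle -ltnS (allP ltm) // andbT.
apply/negP=> degY; have : Y \in [seq Y <- s1 | deg Y == m] by rewrite mem_filter degY.
by rewrite E.
Qed.

Lemma pbw_mon_superword w : monotonic w ->
  pbw_word (mon_superword w) <-> hard_restricted lambda g a d w.
Proof.
move=> mw; split=> [[_ hw] p pw|hw].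
  rewrite -(count_monotonic mw pw); apply: hw.
  apply/flattenP; exists (nseq p.2 p.1); first by apply/mapP; exists p.
  by rewrite mem_nseq eqxx andbT; case: mw => _ /allP; apply.
split=> [|t /mem_mon_superword[p pw ->]]; last by rewrite count_monotonic //; apply: hw.
elim: w {hw} mw => // -[t k] w IH mw; have [_ tw sw] := (monotonic_cons t k w).1 mw.
rewrite -[mon_superword _]/(nseq k t ++ mon_superword w).
elim: k {mw} => [|k IHk] /=; first exact: IH.
rewrite path_min_sorted //; apply/allP => s; rewrite mem_cat mem_nseq.
case/orP=> [/andP[_ /eqP->]|/mem_mon_superword[p pw ->]]; first exact: sl_lexx.
exact/sl_ltW/(allP tw).
Qed.

Lemma superwords_span : generates a -> forall x, lincomb (fun=> True) ev x.
Proof.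
move=> gen x; apply/asboolP.
(* [generates] quantifies over Boolean predicates, so the span is made into one classically. *)
pose A : {pred H} := fun x => `[< lincomb (fun=> True) ev x >].
rewrite -[`[< _ >]]/(x \in A); apply: gen => [|i]; last first.
  have st : nstandard (NLetter i).
    by rewrite /= andbT; apply: standardP => // -[|j x'] [|k y] // _ _ [_]; case: x'.
  apply/asboolP; have -> : a i = ev [:: (exist _ (NLetter i) st : superletter n)]
    by rewrite ev_seq1.
  exact: lincomb_gen.
split=> [|b u v /asboolP Hu /asboolP Hv|u v /asboolP Hu /asboolP Hv]; apply/asboolP.
- by rewrite -(ev_nil lambda a g); apply: lincomb_gen.
- by apply: lincombD => //; apply: lincombZ.
- by apply: lincombM Hu Hv => W X _ _; rewrite -ev_cat; apply: lincomb_gen.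
Qed.

End Basis.

Theorem corollary7 (K : fieldType) (G : zmodType) (lambda : G -> G -> K)
    (lambda_bichar : bicharacter lambda)
    (H : algType K) (S : graded_hopf lambda H)
    (n : nat) (a : 'I_n -> H) (g : 'I_n -> G) (d : 'I_n -> nat)
    (d_gt0 : forall i, (0 < d i)%N)
    (a_homog : forall i, a i \in grading S (g i))
    (a_prim : forall i, primitive_elt S (a i))
    (a_gen : generates a) :
  is_basis
    (fun w : seq (superletter n * nat) =>
       monotonic w /\ hard_restricted lambda g a d w)
    (fun w => sw_eval lambda g a (mon_superword w)).
Proof.
split=> [m w c inj_w Hw sum0 j|x].
  have inj : injective (fun j => mon_superword (w j)).
    by move=> i k E; apply: inj_w; apply: mon_superword_inj E; apply: (Hw _).1.
  pose c' X := \sum_(j | mon_superword (w j) == X) c j.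
  have c'E k : c' (mon_superword (w k)) = c k.
    by rewrite /c' (big_pred1 k) // => i; rewrite (inj_eq inj).
  rewrite -c'E; pose s := [seq mon_superword (w j) | j <- enum 'I_m].
  apply: (pbw_indep lambda_bichar d_gt0 a_homog a_prim (s := s)) => [|X /mapP[i _ ->]||].
  - by rewrite map_inj_uniq ?enum_uniq.
  - by have [mw hw] := Hw i; apply/pbw_mon_superword.
  - by rewrite big_map big_enum /= -[RHS]sum0; apply: eq_bigr => i _; rewrite c'E.
  - by apply: map_f; rewrite mem_enum.
apply: lincomb_trans (superwords_span lambda g a_gen x) => W _.
apply: lincomb_trans (pbw_span lambda_bichar a g d_gt0 W) => X [hX _].
have [srt _] := hX; have [w mw wX] := mon_superword_surj srt.
rewrite -wX in hX *.
apply: (lincomb_gen (fun w => sw_eval lambda g a (mon_superword w))).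
by split=> //; apply/pbw_mon_superword.
Qed.
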